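(* Let $(A+\gamma I),(B+\mu I)\in\mathscr{PC}_2(\mathcal{H})$. Let $r=r(\alpha)$ be a smooth real-valued function of $\alpha$ near $\alpha=0$ with $r(0)=0$, $r'(0)\neq 0$, and $r(\alpha)\neq 0$ for $\alpha\neq 0$. Then (the limit being taken through $\alpha>0$) $$\lim_{\alpha\to 0}D_{r(\alpha)}^{(\alpha,\alpha)}[(A+\gamma I),(B+\mu I)]=\frac{[r'(0)]^2}{8}\,d_{\mathrm{aiHS}}^2[(A+\gamma I),(B+\mu I)].$$ In particular, for $r=2\alpha$, $$\lim_{\alpha\to 0}D_{2\alpha}^{(\alpha,\alpha)}[(A+\gamma I),(B+\mu I)]=\frac12\,d_{\mathrm{aiHS}}^2[(A+\gamma I),(B+\mu I)].$$
   Context: $\mathcal{H}$ is a real separable Hilbert space with $\dim\mathcal{H}=\infty$, $I$ its identity operator; $\mathrm{Tr}(\mathcal{H})$ and $\mathrm{HS}(\mathcal{H})$ are the trace class and Hilbert-Schmidt operators. $\mathrm{Tr}_X(\mathcal{H})=\{A+\gamma I: A\in\mathrm{Tr}(\mathcal{H}),\gamma\in\mathbb{R}\}$, $\mathrm{HS}_X(\mathcal{H})=\{A+\gamma I:A\in\mathrm{HS}(\mathcal{H}),\gamma\in\mathbb{R}\}$, with extended Hilbert-Schmidt norm $\|A+\gamma I\|_{\mathrm{eHS}}^2=\|A\|_{\mathrm{HS}}^2+\gamma^2$. An operator $T$ is positive definite, $T>0$, if $T=T^*$ and there is $M>0$ with $\langle x,Tx\rangle\ge M\|x\|^2$ for all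 $x$. $\mathscr{PC}_2(\mathcal{H})=\{A+\gamma I>0: A=A^*,A\in\mathrm{HS}(\mathcal{H}),\gamma\in\mathbb{R}\}$ (necessarily $\gamma>0$). For $P\in\mathscr{PC}_2(\mathcal{H})$, $\log P\in\mathrm{HS}_X(\mathcal{H})$ is defined by the spectral calculus and $P^s=\exp(s\log P)$, $s\in\mathbb{R}$. Extended Fredholm determinant: for $A+\gamma I\in\mathrm{Tr}_X(\mathcal{H})$, $\gamma\ne0$, $\det_X(A+\gamma I)=\gamma\det(A/\gamma+I)$, with $\det$ the Fredholm determinant. Alpha-Beta Log-Det divergence: for $\alpha,\beta>0$, $r\neq0$, and $(A+\gamma I),(B+\mu I)\in\mathscr{PC}_2(\mathcal{H})$, $$D_r^{(\alpha,\beta)}[(A+\gamma I),(B+\mu I)]=\frac{1}{\alpha\beta}\log\left[\left(\frac{\gamma}{\mu}\right)^{r(\delta-\frac{\alpha}{\alpha+\beta})}\det{}_X\left(\frac{\alpha(\Lambda+\frac{\gamma}{\mu}I)^{r(1-\delta)}+\beta(\Lambda+\frac{\gamma}{\mu}I)^{-r\delta}}{\alpha+\beta}\right)\right],$$ where $\Lambda+\frac{\gamma}{\mu}I=(B+\mu I)^{-1/2}(A+\gamma I)(B+\mu I)^{-1/2}$, $\Lambda\in\mathrm{HS}(\mathcal{H})$, and $\delta=\frac{\alpha\gamma^r}{\alpha\gamma^r+\beta\mu^r}$ (the operator inside $\det_X$ belongs to $\mathrm{Tr}_X(\mathcal{H})$). Affine-invariant Riemannian distance: $d_{\mathrm{aiHS}}[(A+\gamma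 I),(B+\mu I)]=\|\log[(B+\mu I)^{-1/2}(A+\gamma I)(B+\mu I)^{-1/2}]\|_{\mathrm{eHS}}$. *)

(* Defs.v *)
From mathcomp Require Import all_boot all_order all_algebra.
From mathcomp Require Import sesquilinear.
From mathcomp Require Import all_classical all_reals all_analysis.
Set Implicit Arguments.
Unset Strict Implicit.
Unset Printing Implicit Defensive.
Import Order.TTheory GRing.Theory Num.Theory.
Import numFieldNormedType.Exports.
Local Open Scope classical_set_scope.
Local Open Scope ring_scope.

Definition separable (T : topologicalType) : Prop :=
  exists2 D : set T, countable D & dense D.

Definition infinite_dimensional (R : realType) (V : lmodType R) : Prop :=
  forall (n : nat) (v : 'I_n -> V),
    exists x, forall c : 'I_n -> R, x <> \sum_i c i *: v i.

Definition smooth_near (R : realType) (f : R -> R) (x : R) : Prop :=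
  \forall y \near x, forall n, derivable (derive1n n f) y 1.

Section Operators.
Context {R : realType} {H : completeNormedModType R}.
Variable ip : {dot H for @idfun R}.

(* The completeness of H is part of its type; this makes its norm the one
   induced by ip. *)
Definition hilbert_norm : Prop := forall x, `|x| ^+ 2 = ip x x.

Definition orthonormal_basis (e : nat -> H) : Prop :=
  (forall i j, ip (e i) (e j) = (i == j)%:R) /\
  (forall x, series (fun k => ip x (e k) *: e k) @ \oo --> x).

(* One fixed orthonormal basis. The Hilbert-Schmidt norm, the trace of a
   nonnegative operator and the Fredholm determinant are computed in it; none
   of them depends on the choice. *)
Definition onb : nat -> H := xget (fun=> 0) [set e | orthonormal_basis e].

Definition bounded_op (T : H -> H) : Prop := linear T /\ continuous T.

Definition selfadjoint (T : H -> H) : Prop :=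
  bounded_op T /\ forall x y, ip (T x) y = ip x (T y).

Definition positive_definite (T : H -> H) : Prop :=
  selfadjoint T /\ exists2 M : R, 0 < M & forall x, M * `|x| ^+ 2 <= ip x (T x).

Definition add_scalar (A : H -> H) (c : R) : H -> H := fun x => A x + c *: x.

Definition hs_sum (A : H -> H) : \bar R :=
  (\sum_(0 <= k <oo) (`|A (onb k)| ^+ 2)%:E)%E.

Definition hilbert_schmidt (A : H -> H) : Prop :=
  bounded_op A /\ (hs_sum A < +oo)%E.

Definition hs_norm (A : H -> H) : R := Num.sqrt (fine (hs_sum A)).

(* P is |A|: the nonnegative square root of A^* A. *)
Definition is_abs (A P : H -> H) : Prop :=
  [/\ selfadjoint P, (forall x, 0 <= ip x (P x)) &
      forall x y, ip (P x) (P y) = ip (A x) (A y)].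

Definition trace_class (A : H -> H) : Prop :=
  bounded_op A /\
  exists2 P, is_abs A P & (\sum_(0 <= k <oo) (ip (onb k) (P (onb k)))%:E < +oo)%E.

(* Trace of the n-th exterior power of A, as the sum over all indices
   s_1, ..., s_n of det (<e_{s_a}, A e_{s_b}>) / n!. *)
Definition trace_exterior (A : H -> H) (n : nat) : R :=
  limn (fun N => (n`!%:R)^-1 * \sum_(s : {ffun 'I_n -> 'I_N})
    \det (\matrix_(a < n, b < n) ip (onb (s a)) (A (onb (s b))))).

(* det (A + I), by Fredholm's series. *)
Definition fredholm_det (A : H -> H) : R := limn (series (trace_exterior A)).

(* The decomposition T = C + c I is unique because H is infinite-dimensional. *)
Definition detX (T : H -> H) : R :=
  xget 0 [set d | exists (C : H -> H) (c : R), [/\ trace_class C, c != 0, T = add_scalar C c &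
                               d = c * fredholm_det (fun x => c^-1 *: C x)]].

Definition ehs_norm (T : H -> H) : R :=
  xget 0 [set d | exists (A : H -> H) (c : R), [/\ hilbert_schmidt A, T = add_scalar A c &
                               d = Num.sqrt (hs_norm A ^+ 2 + c ^+ 2)]].

(* f(T) for T having an orthonormal basis of eigenvectors, as every self-adjoint
   element of HS_X(H) does; it does not depend on the eigenbasis. *)
Definition spectral_calculus (f : R -> R) (T : H -> H) : H -> H :=
  xget (fun=> 0) [set S | bounded_op S /\
    exists (e : nat -> H) (lambda : nat -> R),
      [/\ orthonormal_basis e, (forall k, T (e k) = lambda k *: e k) &
          forall k, S (e k) = f (lambda k) *: e k]].

Definition op_log (P : H -> H) : H -> H := spectral_calculus (@ln R) P.

Definition op_exp (T : H -> H) : H -> H :=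
  fun x => limn (series (fun k => (k`!%:R)^-1 *: iter k T x)).

Definition op_pow (P : H -> H) (s : R) : H -> H :=
  op_exp (fun x => s *: op_log P x).

(* A + gamma I belongs to PC_2(H). *)
Definition PC2 (A : H -> H) (gamma : R) : Prop :=
  [/\ hilbert_schmidt A, selfadjoint A & positive_definite (add_scalar A gamma)].

(* (B + mu I)^{-1/2} (A + gamma I) (B + mu I)^{-1/2} *)
Definition whitened (A : H -> H) (gamma : R) (B : H -> H) (mu : R) : H -> H :=
  let Q := op_pow (add_scalar B mu) (- 2^-1) in Q \o add_scalar A gamma \o Q.

Definition AB_logdet (alpha beta r : R)
    (A : H -> H) (gamma : R) (B : H -> H) (mu : R) : R :=
  let delta := alpha * gamma `^ r / (alpha * gamma `^ r + beta * mu `^ r) in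
  let X := whitened A gamma B mu in
  (alpha * beta)^-1 *
  ln ((gamma / mu) `^ (r * (delta - alpha / (alpha + beta))) *
      detX (fun x => (alpha + beta)^-1 *:
              (alpha *: op_pow X (r * (1 - delta)) x +
               beta *: op_pow X (- (r * delta)) x))).

Definition d_aiHS (A : H -> H) (gamma : R) (B : H -> H) (mu : R) : R :=
  ehs_norm (op_log (whitened A gamma B mu)).

End Operators.

(* Main.v *)
(* Whitening gives X = (B + mu I)^{-1/2} (A + gamma I) (B + mu I)^{-1/2} = L + c I
   with c = gamma / mu and L self-adjoint Hilbert-Schmidt, so X has an orthonormal
   eigenbasis with eigenvalues x_k, and y_k = ln (x_k / c) is square summable with
   d_aiHS^2 = sum_k y_k^2 + (ln c)^2.  Factoring the value at c out of the operator
   inside det_X, the argument of the logarithm becomes cosh (r ln c / 2) det (I + K),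
   where K is diagonal in that basis with eigenvalues
   d e^{r(1-d) y_k} + (1-d) e^{-r d y_k} - 1, which are nonnegative and equal to
   r^2 d (1-d) y_k^2 / 2 up to O(|r|^3 y_k^2); here d -> 1/2.  Hence
   tr K ~ r^2 / 8 sum_k y_k^2, and only det (I + K) = 1 + tr K + O((tr K)^2) is
   needed: Cauchy-Schwarz bounds the entries of the nonnegative matrix
   <b_i, K b_j>, so the n-th term of Fredholm's series is at most (tr K)^n in any
   orthonormal basis b, and the determinant is never computed as a product. *)
Require Import Defs.
From HB Require Import structures.
From mathcomp Require Import all_boot all_order all_algebra.
From mathcomp Require Import sesquilinear perm.
From mathcomp Require Import all_classical all_reals all_analysis.
From mathcomp Require Import ring lra.
Set Implicit Arguments.
Unset Strict Implicit.
Unset Printing Implicit Defensive.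
Import Order.TTheory GRing.Theory Num.Theory.
Import numFieldNormedType.Exports.
Local Open Scope classical_set_scope.
Local Open Scope ring_scope.

(** * Inner products and orthonormal bases *)

(** The obstacle is that the numbers y_k are square summable but need not be summable, so any term
    linear in y_k would spoil the trace. The weight d is exactly the one that cancels it, and this
    makes K trace class. The constant 1/8 arises twice: as d (1-d) / 2 at d = 1/2 in front of the
    sum of y_k^2, and as (1/2)^2 / 2 in cosh (r ln c / 2) - 1. The agreement of the two lets the
    Hilbert-Schmidt part and the scalar part combine into one extended norm. Dividing by a^2 is
    harmless because every error is o(r^2) while r / a converges. [detX], [ehs_norm] and
    [spectral_calculus] are choices by [xget]; evaluating them takes a witness and a proof that all
    candidates agree. For the first two, agreement holds because the non-scalar part tends to 0
    along the basis while c I does not; for the third, two eigenbases of one operator are compared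
    coefficient by coefficient. *)

Lemma cvg_nneseries (R : realType) (a : nat -> R) (l : R) :
  series a n @[n --> \oo] --> l ->
  (\sum_(0 <= k <oo) (a k)%:E = l%:E)%E.
Proof.
move=> al; apply: cvg_lim => //.
under eq_fun do rewrite sumEFin.
by apply: cvg_EFin => //; exact: nearW.
Qed.

Section InnerProduct.
Context (R : realType) (H : completeNormedModType R) (ip : {dot H for @idfun R}).
Context (Hnorm : hilbert_norm ip).
Implicit Types (x y z : H) (e : nat -> H).

Lemma ipC x y : ip x y = ip y x.
Proof. by rewrite hermC expr0 mul1r. Qed.

Lemma ipDl x y z : ip (x + y) z = ip x z + ip y z.
Proof. by rewrite linearDl. Qed.

Lemma ipDr x y z : ip z (x + y) = ip z x + ip z y.
Proof. by rewrite linearD. Qed.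

Lemma ipBl x y z : ip (x - y) z = ip x z - ip y z.
Proof. by rewrite linearBl. Qed.

Lemma ipBr x y z : ip z (x - y) = ip z x - ip z y.
Proof. by rewrite linearB. Qed.

Lemma ipZl (a : R) x z : ip (a *: x) z = a * ip x z.
Proof. by rewrite linearZl_LR. Qed.

Lemma ipZr (a : R) x z : ip z (a *: x) = a * ip z x.
Proof. by rewrite ipC ipZl ipC. Qed.

Lemma ip0l z : ip 0 z = 0.
Proof. by rewrite linear0l. Qed.

Lemma ip0r z : ip z 0 = 0.
Proof. by rewrite ipC ip0l. Qed.

Lemma ip_suml (I : Type) (s : seq I) (P : pred I) (F : I -> H) z :
  ip (\sum_(i <- s | P i) F i) z = \sum_(i <- s | P i) ip (F i) z.
Proof. by rewrite (big_morph (ip^~ z) (fun x y => ipDl x y z) (ip0l z)). Qed.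

Lemma ipxx x : ip x x = `|x| ^+ 2.
Proof. by rewrite Hnorm. Qed.

Lemma normB_sq x y : `|x - y| ^+ 2 = `|x| ^+ 2 - 2 * ip x y + `|y| ^+ 2.
Proof.
by rewrite -!ipxx ipBl !ipBr (ipC y x); ring.
Qed.

(* Cauchy-Schwarz for a semi-inner product with a = <x,x>, b = <x,y>,
   c = <y,y>; it also serves the form of a nonnegative operator. *)
Lemma quadratic_cauchy_schwarz (a b c : R) : 0 <= c ->
  (forall t : R, 0 <= a - 2 * t * b + t ^+ 2 * c) -> b ^+ 2 <= a * c.
Proof.
rewrite le0r => /orP[/eqP-> h|c0 h].
  rewrite mulr0; have [->|b0] := eqVneq b 0; first by rewrite expr0n.
  (* With c = 0 the form is affine in t; this t gives it the value -1. *)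
  have := h ((a + 1) / (2 * b)).
  have -> : a - 2 * ((a + 1) / (2 * b)) * b + ((a + 1) / (2 * b)) ^+ 2 * 0 = -1.
    by field.
  by rewrite ler0N1.
have := h (b / c).
have -> : a - 2 * (b / c) * b + (b / c) ^+ 2 * c = (a * c - b ^+ 2) / c.
  by field; rewrite gt_eqF.
by rewrite pmulr_lge0 ?invr_gt0// subr_ge0.
Qed.

Lemma ip_le_norm x y : `|ip x y| <= `|x| * `|y|.
Proof.
rewrite -(@ler_pXn2r _ 2)// ?nnegrE ?mulr_ge0// exprMn real_normK ?num_real//.
apply: quadratic_cauchy_schwarz => [|t]; first exact: sqr_ge0.
have -> : `|x| ^+ 2 - 2 * t * ip x y + t ^+ 2 * `|y| ^+ 2 = `|x - t *: y| ^+ 2.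
  by rewrite normB_sq ipZr normrZ exprMn real_normK ?num_real//; ring.
exact: sqr_ge0.
Qed.

Lemma cvg_ipl (T : Type) (F : set_system T) {FF : Filter F} (f : T -> H) x z :
  f t @[t --> F] --> x -> ip (f t) z @[t --> F] --> ip x z.
Proof.
move=> fx; apply/cvgrPdist_le => eps eps0.
have z0 : 0 < `|z| + 1 by rewrite ltr_wpDl.
move/cvgrPdist_le : fx => /(_ (eps / (`|z| + 1))); rewrite divr_gt0// => /(_ isT).
apply: filterS => t ft; rewrite -ipBl (le_trans (ip_le_norm _ _))//.
rewrite (@le_trans _ _ (`|x - f t| * (`|z| + 1)))//.
  by rewrite ler_wpM2l// lerDl.
by rewrite -ler_pdivlMr.
Qed.

Definition orthonormal e := forall i j, ip (e i) (e j) = (i == j)%:R.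

Section Orthonormal.
Context (e : nat -> H) (he : orthonormal e).

Lemma orthonormal_norm k : `|e k| = 1.
Proof.
by apply/eqP; rewrite -(@eqrXn2 _ 2)// -ipxx he eqxx expr1n.
Qed.

Lemma ip_sum_orthonormal (a : nat -> R) m n j :
  ip (\sum_(m <= k < n) a k *: e k) (e j) = if (m <= j < n)%N then a j else 0.
Proof.
rewrite ip_suml; under eq_bigr do rewrite ipZl he.
case: ifP => mjn.
  rewrite (bigD1_seq j)//= ?mem_index_iota ?iota_uniq// eqxx mulr1.
  by rewrite big1 ?addr0// => i /negbTE->; rewrite mulr0.
rewrite big_seq big1// => i; rewrite mem_index_iota => imn.
by case: eqVneq => [ij|]; rewrite ?mulr0//; rewrite -ij imn in mjn.
Qed.

Lemma norm_sum_orthonormal (a : nat -> R) m n :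
  `|\sum_(m <= k < n) a k *: e k| ^+ 2 = \sum_(m <= k < n) a k ^+ 2.
Proof.
rewrite -ipxx [X in ip _ X = _]big_seq.
rewrite ipC ip_suml [RHS]big_seq; apply: eq_bigr => j; rewrite mem_index_iota => jmn.
by rewrite ipZl ipC ip_sum_orthonormal jmn expr2.
Qed.

Lemma bessel x n : \sum_(0 <= k < n) ip x (e k) ^+ 2 <= `|x| ^+ 2.
Proof.
have := sqr_ge0 `|x - \sum_(0 <= k < n) ip x (e k) *: e k|.
rewrite normB_sq norm_sum_orthonormal ipC ip_suml.
under eq_bigr do rewrite ipZl (ipC (e _)) -expr2.
by lra.
Qed.

(** By Pythagoras the squared norm of a block of the series is the same block of the convergent
    series of [a k ^+ 2], so the partial sums are Cauchy and completeness applies. *)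
Lemma riesz_fischer (a : nat -> R) (M : R) :
  (forall n, \sum_(0 <= k < n) a k ^+ 2 <= M) ->
  cvgn (series (fun k => a k *: e k)).
Proof.
move=> aM; apply/cauchy_cvgP/cauchy_seriesP => eps eps0.
have : cvgn (series (fun k => a k ^+ 2)).
  apply: nondecreasing_is_cvgn.
    by apply/nondecreasing_series => k _ _; exact: sqr_ge0.
  by exists M => _ [n _ <-]; exact: aM.
move/cauchy_cvgP/cauchy_seriesP/(_ (eps ^+ 2)); rewrite exprn_gt0// => /(_ isT).
apply: filterS => -[m n] /= h.
rewrite -(@ltr_pXn2r _ 2)// ?nnegrE ?(ltW eps0)// norm_sum_orthonormal.
by rewrite (le_lt_trans _ h)// ler_norm.
Qed.

(** Bessel's inequality makes the Fourier series of x converge; x minus its sum has all coefficients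
    zero. *)
Lemma total_orthonormal_basis :
  (forall x, (forall k, ip x (e k) = 0) -> x = 0) -> orthonormal_basis ip e.
Proof.
move=> tot; split=> // x.
have cv : cvgn (series (fun k => ip x (e k) *: e k)).
  exact: (riesz_fischer (bessel x)).
suff xE : x = limn (series (fun k => ip x (e k) *: e k)).
  by rewrite [X in _ --> X]xE.
apply/eqP; rewrite -subr_eq0; apply/eqP/tot => j.
rewrite ipBl; apply/eqP; rewrite subr_eq0; apply/eqP.
apply/esym/(norm_cvg_unique (cvg_ipl (z := e j) cv)).
apply: cvg_near_cst; near=> n.
rewrite ip_sum_orthonormal leq0n /=; case: ltnP => //.
suff : (j < n)%N by case: ltnP.
by near: n; exact: nbhs_infty_gt.
Unshelve. all: by end_near. Qed.

End Orthonormal.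

Section Basis.
Context (e : nat -> H) (he : orthonormal_basis ip e).

Lemma basis_orthonormal : orthonormal e.
Proof. by case: he. Qed.

Lemma coef_inj x y : (forall k, ip x (e k) = ip y (e k)) -> x = y.
Proof.
move=> xy; have [_ hx] := he; have := hx y.
under eq_fun do rewrite -xy.
exact: norm_cvg_unique (hx x).
Qed.

Lemma parseval x y :
  series (fun k => ip x (e k) * ip y (e k)) n @[n --> \oo] --> ip x y.
Proof.
have [_ hx] := he; apply: cvg_trans (cvg_ipl (z := y) (hx x)).
apply: near_eq_cvg; near=> n.
by rewrite ip_suml /series/=; apply: eq_bigr => k _; rewrite ipZl (ipC y).
Unshelve. all: by end_near. Qed.

Arguments parseval : clear implicits.

Lemma parseval_sq x :
  (\sum_(0 <= k <oo) ((ip x (e k)) ^+ 2)%:E = (`|x| ^+ 2)%:E)%E.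
Proof.
by apply: cvg_nneseries; rewrite -ipxx; exact: parseval.
Qed.

End Basis.
End InnerProduct.
Arguments parseval {R H ip} Hnorm {e} he x y.

(** * Bounded linear operators *)

Section BoundedOp.
Context (R : realType) (H : completeNormedModType R).
Implicit Types (x y : H) (T : H -> H).

Lemma linearopB T : linear T -> forall x y, T (x - y) = T x - T y.
Proof. by move=> lT x y; rewrite -[- y]scaleN1r addrC lT scaleN1r addrC. Qed.

Lemma linearop0 T : linear T -> T 0 = 0.
Proof. by move=> lT; have := linearopB lT 0 0; rewrite !subrr. Qed.

Lemma linearopZ T : linear T -> forall (a : R) x, T (a *: x) = a *: T x.
Proof. by move=> lT a x; have := lT a x 0; rewrite (linearop0 lT) !addr0. Qed.

Lemma linearopD T : linear T -> forall x y, T (x + y) = T x + T y.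
Proof. by move=> lT x y; have := lT 1 x y; rewrite !scale1r. Qed.

Lemma linearop_sum T : linear T -> forall (I : Type) (s : seq I) (F : I -> H),
  T (\sum_(i <- s) F i) = \sum_(i <- s) T (F i).
Proof.
by move=> lT I s F; rewrite (big_morph T (linearopD lT) (linearop0 lT)).
Qed.

Lemma bounded_opP T : bounded_op T <->
  linear T /\ exists2 M : R, 0 <= M & forall x, `|T x| <= M * `|x|.
Proof.
split=> -[lT].
  move=> cT; split=> //.
  pose f : {linear H -> H} := HB.pack T (GRing.isLinear.Build R H H *:%R T lT).
  have /linear_boundedP := @continuous_linear_bounded _ _ _ (0 : H) f (cT 0).
  move=> h; near (+oo : set_system R) => M; exists M => //.
  exact: (near h M).
case=> M M0 TM; split=> // x; apply/cvgrPdist_le => eps eps0.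
have M1 : 0 < M + 1 by rewrite ltr_wpDl.
near=> y; rewrite -(linearopB lT) (le_trans (TM _))//.
rewrite (@le_trans _ _ ((M + 1) * `|x - y|))//.
  by rewrite ler_wpM2r// lerDl.
rewrite mulrC -ler_pdivlMr//; near: y.
by apply: cvgr_dist_le; rewrite ?divr_gt0//; exact: cvg_id.
Unshelve. all: by end_near. Qed.

End BoundedOp.

(** * Operators diagonal in an orthonormal basis *)

Section Diagonal.
Context (R : realType) (H : completeNormedModType R) (ip : {dot H for @idfun R}).
Context (Hnorm : hilbert_norm ip).
Implicit Types (x y z : H) (l : nat -> R) (T : H -> H).
Context (e : nat -> H) (he : orthonormal_basis ip e).

(** Continuity carries [T] through the Fourier series of x. Identities between diagonal operators
    can then be checked on coefficients by [coef_inj]. *)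
Lemma ip_eigen T l : bounded_op T -> (forall k, T (e k) = l k *: e k) ->
  forall x j, ip (T x) (e j) = l j * ip x (e j).
Proof.
move=> bT Te x j; have [lT cT] := bT.
have [_ hx] := he; have ho := basis_orthonormal he.
have h1 : ip (T (series (fun k => ip x (e k) *: e k) n)) (e j) @[n --> \oo] --> ip (T x) (e j).
  apply: (cvg_ipl Hnorm); apply: continuous_cvg; [exact: cT|exact: hx].
apply: (norm_cvg_unique h1); apply: cvg_near_cst; near=> n.
rewrite /series/= (linearop_sum lT).
under eq_bigr do rewrite (linearopZ lT) Te scalerA mulrC.
rewrite (ip_sum_orthonormal ho) leq0n /=; case: ltnP => // nj.
suff : (j < n)%N by rewrite ltnNge nj.
by near: n; exact: nbhs_infty_gt.
Unshelve. all: by end_near. Qed.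

(** The series converges when [l] is bounded. It supplies the witness for [spectral_calculus] and
    the closed form of [op_exp]. *)
Definition diag l x := limn (series (fun k => (l k * ip x (e k)) *: e k)).

Lemma ip_diag l (M : R) : (forall k, `|l k| <= M) ->
  forall x j, ip (diag l x) (e j) = l j * ip x (e j).
Proof.
move=> lM x j; have ho := basis_orthonormal he.
have cv : cvgn (series (fun k => (l k * ip x (e k)) *: e k)).
  apply: (riesz_fischer Hnorm ho (M := M ^+ 2 * `|x| ^+ 2)) => n.
  rewrite (@le_trans _ _ (M ^+ 2 * \sum_(0 <= k < n) ip x (e k) ^+ 2))//.
    rewrite mulr_sumr; apply: ler_sum => k _; rewrite exprMn ler_wpM2r ?sqr_ge0//.
    by rewrite -[l k ^+ 2]real_normK ?num_real// lerXn2r ?nnegrE// (le_trans _ (lM k)).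
  by rewrite ler_wpM2l ?sqr_ge0// (bessel Hnorm ho).
apply/esym/(norm_cvg_unique _ (cvg_ipl Hnorm (z := e j) cv)).
apply: cvg_near_cst; near=> n.
rewrite (ip_sum_orthonormal ho) leq0n /=; case: ltnP => // nj.
suff : (j < n)%N by rewrite ltnNge nj.
by near: n; exact: nbhs_infty_gt.
Unshelve. all: by end_near. Qed.

Lemma norm_le_coef (M : R) x y : 0 <= M ->
  (forall k, `|ip x (e k)| <= M * `|ip y (e k)|) -> `|x| <= M * `|y|.
Proof.
move=> M0 xy; rewrite -(@ler_pXn2r _ 2)// ?nnegrE ?mulr_ge0// exprMn -!(ipxx Hnorm).
apply: (ler_cvg_to (parseval Hnorm he x x)
  (cvgM (cvg_cst (M ^+ 2)) (parseval Hnorm he y y))).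
apply: nearW => n; rewrite /series/= mulr_sumr; apply: ler_sum => k _.
rewrite -!expr2 -exprMn -[leLHS]real_normK ?num_real// -[leRHS]real_normK ?num_real//.
by rewrite lerXn2r ?nnegrE// (le_trans (xy k))// normrM (ger0_norm M0).
Qed.

Section BoundedDiagonal.
Context l (M : R) (lM : forall k, `|l k| <= M).

Lemma bounded_op_diag : bounded_op (diag l).
Proof.
apply/bounded_opP; split=> [a x y|].
  apply: (coef_inj he) => k.
  by rewrite ipDl ipZl !(ip_diag lM) ipDl ipZl; ring.
have M0 : 0 <= M := le_trans (normr_ge0 (l 0%N)) (lM 0%N).
exists M => // x; apply: norm_le_coef => // k.
by rewrite (ip_diag lM) normrM ler_wpM2r.
Qed.

Lemma diag_basis k : diag l (e k) = l k *: e k.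
Proof.
apply: (coef_inj he) => j; rewrite (ip_diag lM) ipZl.
by rewrite (basis_orthonormal he); case: eqVneq => [->//|]; rewrite !mulr0.
Qed.

End BoundedDiagonal.

Lemma cvg_ip_eigen T l x y : bounded_op T -> (forall k, T (e k) = l k *: e k) ->
  series (fun k => l k * (ip x (e k) * ip y (e k))) n @[n --> \oo] --> ip (T x) y.
Proof.
move=> bT Te; have := parseval Hnorm he (T x) y.
by under eq_fun do under eq_fun do rewrite (ip_eigen bT Te) -mulrA.
Qed.
Arguments cvg_ip_eigen : clear implicits.

Lemma eigen_selfadjoint T l : bounded_op T -> (forall k, T (e k) = l k *: e k) ->
  selfadjoint ip T.
Proof.
move=> bT Te; split=> // x y; have h := cvg_ip_eigen T l x y bT Te.
have := cvg_ip_eigen T l y x bT Te; rewrite (ipC ip (T y)).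
under eq_fun do under eq_fun do rewrite (mulrC (ip y _)).
exact: norm_cvg_unique.
Qed.

Lemma eigen_bounded T l : bounded_op T -> (forall k, T (e k) = l k *: e k) ->
  exists M : R, forall k, `|l k| <= M.
Proof.
move=> /bounded_opP[_ [M _ TM]] Te; exists M => k; have := TM (e k).
by rewrite Te normrZ (orthonormal_norm Hnorm (basis_orthonormal he)) !mulr1.
Qed.

End Diagonal.
Arguments cvg_ip_eigen {R H ip} Hnorm {e} he {T l} x y.

(** * The spectral theorem for Hilbert-Schmidt operators *)

(** An ultrafilter on the compact interval [-M, M] converges to its cluster point. One ultrafilter
    thus serves all coefficients of a bounded sequence at once, in place of a diagonal extraction of
    subsequences. *)
Lemma ultra_bounded_cvg (R : realType) (T : Type) (U : set_system T) (f : T -> R)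
  (M : R) : UltraFilter U -> (forall t, `|f t| <= M) -> cvg (f t @[t --> U]).
Proof.
move=> UU fM.
have UM : U (f @^-1` `[- M, M]).
  by apply: filterE => t /=; rewrite in_itv/= -ler_norml.
have [c [_ cf]] := @segment_compact R (- M) M (f @ U) _ UM.
apply/cvg_ex; exists c => V Vc.
have [//|nV] := in_ultra_setVsetC (f @^-1` V) UU.
by have [x []] := cf (~` V) V nV Vc.
Qed.

Lemma cvg_sum_near (R : realType) (V : normedModType R) (T : Type)
    (F : set_system T) {FF : Filter F} (f : nat -> T -> V) (l : nat -> V) n :
  (forall k, f k t @[t --> F] --> l k) ->
  \sum_(0 <= k < n) f k t @[t --> F] --> \sum_(0 <= k < n) l k.
Proof.
move=> fl; elim: n => [|n IH].
  rewrite big_geq//; have -> : (fun t => \sum_(0 <= k < 0) f k t) = cst 0.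
    by apply/funext => t; rewrite big_geq.
  exact: cvg_cst.
rewrite big_nat_recr//=.
have -> : (fun t => \sum_(0 <= k < n.+1) f k t) =
    (fun t => \sum_(0 <= k < n) f k t) \+ f n.
  by apply/funext => t; rewrite big_nat_recr.
exact: cvgD.
Qed.

Lemma summable_cvgn (R : realType) (a : nat -> R) : (forall k, 0 <= a k) ->
  (\sum_(0 <= k <oo) (a k)%:E < +oo)%E -> cvgn (series a).
Proof.
move=> a0 alt; apply: nondecreasing_is_cvgn.
  exact/nondecreasing_series.
exists (fine (\sum_(0 <= k <oo) (a k)%:E)%E) => _ [n _ <-].
rewrite -lee_fin fineK; last first.
  by rewrite ge0_fin_numE//; apply: nneseries_ge0 => k _ _; rewrite lee_fin.
by rewrite -sumEFin; apply: nneseries_lim_ge => k _ _; rewrite lee_fin.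
Qed.

Section Spectral.
Context (R : realType) (H : completeNormedModType R) (ip : {dot H for @idfun R}).
Context (Hnorm : hilbert_norm ip).
Implicit Types (x y z : H) (T A : H -> H).

Definition orthogonal_to (E : set H) x := forall y, E y -> ip x y = 0.

Definition eigenvector A x := exists l : R, A x = l *: x.

(* Zorn's lemma needs only this of A; it holds for A = 0 too, which yields the
   existence of an orthonormal basis. *)
Definition eigenvectors_abound A := forall E : set H, E `<=` eigenvector A ->
  forall w, w != 0 -> orthogonal_to E w ->
  exists v, [/\ v != 0, orthogonal_to E v & eigenvector A v].

Definition orthonormal_set (E : set H) :=
  forall x y, E x -> E y -> ip x y = (x == y)%:R.

(** Zorn's lemma on orthonormal sets of eigenvectors: a nonzero w orthogonal to a maximal set would
    yield an eigenvector orthogonal to it, which could be normalized and adjoined. *)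
Lemma maximal_eigenset A : bounded_op A -> eigenvectors_abound A ->
  exists E, [/\ orthonormal_set E, E `<=` eigenvector A &
    forall w, orthogonal_to E w -> w = 0].
Proof.
move=> [lA _] Aev.
pose P := [set E | orthonormal_set E /\ E `<=` eigenvector A].
have [F FP Ftot|E [[Eo Ee] Emax]] := @Zorn_bigcup _ P.
  split=> [x y [X FX Xx] [Y FY Yy]|x [X FX Xx]]; last by have [_] := FP _ FX; exact.
  have [XY|YX] := Ftot _ _ FX FY.
    by have [+ _] := FP _ FY; apply => //; exact: XY.
  by have [+ _] := FP _ FX; apply => //; exact: YX.
exists E; split=> // w Ew; apply/eqP/negP => /negP w0.
have [v [v0 Ev [l Av]]] := Aev E Ee w w0 Ew.
pose u := `|v|^-1 *: v.
have uu : ip u u = 1.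
  rewrite (ipxx Hnorm) normrZ normfV normr_id mulVf ?expr1n//.
  by rewrite normr_eq0.
have Eu : orthogonal_to E u by move=> y Ey; rewrite ipZl Ev// mulr0.
have nEu : ~ E u by move=> /Eu; rewrite uu => /eqP; rewrite oner_eq0.
apply: (Emax (E `|` [set u])).
  by split=> [x Ex|EuE]; [left|apply: nEu; apply: EuE; right].
split=> [x y [Ex|->] [Ey|->]|x [/Ee//|->]].
- exact: Eo.
- by rewrite ipC Eu//; case: eqVneq => // xu; rewrite xu in Ex.
- by rewrite Eu//; case: eqVneq => // yu; rewrite -yu in Ey.
- by rewrite uu eqxx.
- by exists l; rewrite (linearopZ lA) Av !scalerA mulrC.
Qed.

(** Distinct members lie at distance sqrt 2. The threshold 1 is the sum of the two radii 1/2 used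
    for countability. *)
Lemma orthonormal_set_dist (E : set H) x y : orthonormal_set E -> E x -> E y ->
  `|x - y| < 1 -> x = y.
Proof.
move=> Eo Ex Ey; have [//|xy] := eqVneq x y.
rewrite -(@ltr_pXn2r _ 2)// ?nnegrE// (normB_sq Hnorm) -!(ipxx Hnorm) !Eo// !eqxx.
by rewrite (negbTE xy) expr1n /= => h; exfalso; lra.
Qed.

(** Picking for each member a point of the dense set within 1/2 is injective on [E]. *)
Lemma orthonormal_set_countable (E : set H) : separable H -> orthonormal_set E ->
  countable E.
Proof.
move=> [D cD dD] Eo.
have pick x : exists d, D d /\ `|x - d| < 2^-1.
  have [|d [xd Dd]] := dD (ball x 2^-1) _ (ball_open _ _).
    by exists x; exact: ballxx.
  by exists d; split=> //; move: xd; rewrite -ball_normE.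
have [f fP] := choice pick.
have /countable_injP[g gi] := cD.
apply/countable_injP; exists (g \o f) => x y; rewrite !inE => Ex Ey /= gxy.
have fxy : f x = f y by apply: gi => //; rewrite inE; have [] := fP x; have [] := fP y.
apply: (orthonormal_set_dist Eo Ex Ey).
have [_ h1] := fP x; have [_ h2] := fP y; rewrite -fxy distrC in h2.
have -> : x - y = (x - f x) + (f x - y) by rewrite addrA subrK.
by rewrite (le_lt_trans (ler_normD _ _))// (splitr 1) div1r ltrD.
Qed.

(** A finite total orthonormal set would span [H] by the finite Fourier expansion. *)
Lemma orthonormal_set_infinite (E : set H) : infinite_dimensional H ->
  orthonormal_set E -> (forall w, orthogonal_to E w -> w = 0) -> infinite_set E.
Proof.
move=> Hdim Eo Etot /finite_seqP[s0 Es0].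
have [s su Es] : exists2 s, uniq s & E = [set` s].
  exists (undup s0); first exact: undup_uniq.
  by rewrite Es0; apply/seteqP; split=> x /=; rewrite mem_undup.
have [x xP] := Hdim (size s) (fun i => nth 0 s i).
apply: (xP (fun i => ip x (nth 0 s i))).
rewrite -(big_mkord xpredT (fun i => ip x (nth 0 s i) *: nth 0 s i)).
rewrite -(big_nth 0 xpredT (fun y => ip x y *: y)).
apply/eqP; rewrite -subr_eq0; apply/eqP/Etot => y; rewrite Es /= => ys.
rewrite ipBl ip_suml (bigD1_seq y)//= big_seq_cond big1 => [|z /andP[zs zy]].
  have Ey : E y by rewrite Es.
  by rewrite ipZl (Eo y y)// eqxx mulr1 addr0 subrr.
by rewrite ipZl (Eo z y) ?Es// (negbTE zy) mulr0.
Qed.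

(** Separability makes the maximal set countable and the dimension makes it infinite, so it can be
    enumerated by [nat] without repetition. *)
Lemma exists_eigenbasis A : separable H -> infinite_dimensional H ->
  bounded_op A -> eigenvectors_abound A ->
  exists (e : nat -> H) (l : nat -> R),
    orthonormal_basis ip e /\ forall k, A (e k) = l k *: e k.
Proof.
move=> Hsep Hdim bA Aev.
have [E [Eo Ee Etot]] := maximal_eigenset bA Aev.
have : ([set: nat] #= E)%card.
  rewrite card_eq_sym; apply: eq_card_nat; first exact: orthonormal_set_countable.
  exact: orthonormal_set_infinite.
move=> /card_set_bijP[e [eE ei es]].
have [l lP] := choice (fun k => Ee (e k) (eE k I)).
exists e, l; split=> //; apply: (total_orthonormal_basis Hnorm).
  move=> i j; rewrite (Eo _ _ (eE i I) (eE j I)).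
  by congr (nat_of_bool _)%:R; apply/eqP/eqP => [|->//]; apply: ei; rewrite inE.
move=> x xe; apply: Etot => y /es[k _ <-]; exact: xe.
Qed.

Lemma eigenvectors_abound0 : eigenvectors_abound (fun=> 0).
Proof.
by move=> E _ w w0 Ew; exists w; split=> //; exists 0; rewrite scale0r.
Qed.

Lemma exists_onb : separable H -> infinite_dimensional H ->
  orthonormal_basis ip (onb ip).
Proof.
move=> Hsep Hdim; rewrite /onb; case: xgetP => [e -> //|none].
have [|e [l [he _]]] := exists_eigenbasis Hsep Hdim _ eigenvectors_abound0.
  by split; [move=> a x y; rewrite scaler0 addr0|exact: cst_continuous].
by have := none e.
Qed.

(** * Eigenvectors of a self-adjoint Hilbert-Schmidt operator *)

Section Compact.
Context (A : H -> H) (b : nat -> H).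
Context (sA : selfadjoint ip A) (hb : orthonormal_basis ip b).
Context (hs : cvgn (series (fun k => `|A (b k)| ^+ 2))).

(* The coefficients <A x_n, b_j> converge along an ultrafilter because they are
   bounded, and <A x_n, b_j>^2 <= |A b_j|^2 makes the tails uniformly small. *)
Lemma cvg_image_bounded (x : nat -> H) (U : set_system nat) :
  UltraFilter U -> (forall n, `|x n| <= 1) -> cvg (A (x n) @[n --> U]).
Proof.
move=> UU x1; have [bA Asym] := sA; have [_ [M M0 AM]] := (bounded_opP A).1 bA.
have ho := basis_orthonormal hb.
pose c n j := ip (A (x n)) (b j).
have cM n j : `|c n j| <= M.
  rewrite (le_trans (ip_le_norm Hnorm _ _))// (orthonormal_norm Hnorm ho) mulr1.
  by rewrite (le_trans (AM _))// ler_piMr.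
have cc j : cvg (c n j @[n --> U]) by apply: (ultra_bounded_cvg UU) => n; exact: cM.
apply: cauchy_cvg; apply: cauchy_exP => eps eps0.
pose C := limn (series (fun k => `|A (b k)| ^+ 2)).
have eps2 : 0 < eps / 2 by rewrite divr_gt0.
have : \forall N \near \oo, C - series (fun k => `|A (b k)| ^+ 2) N < (eps / 2) ^+ 2.
  have /cvgrPdist_lt/(_ ((eps / 2) ^+ 2)) := hs; rewrite exprn_gt0// => /(_ isT).
  by apply: filterS => N /(le_lt_trans (ler_norm _)).
move=> /filter_ex[N CN].
have tail n : `|A (x n) - \sum_(0 <= j < N) c n j *: b j| < eps / 2.
  rewrite -(@ltr_pXn2r _ 2)// ?nnegrE ?(ltW eps2)//; apply: le_lt_trans CN.
  rewrite (normB_sq Hnorm) (norm_sum_orthonormal Hnorm ho).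
  rewrite (ipC ip) ip_suml; under eq_bigr do rewrite ipZl (ipC ip (b _)) -expr2.
  rewrite -(ipxx Hnorm).
  set S := \sum_(_ <= _ < _) _.
  have -> : ip (A (x n)) (A (x n)) - 2 * S + S = ip (A (x n)) (A (x n)) - S by ring.
  rewrite lerBlDr.
  apply: (cvgr_to_le (parseval Hnorm hb (A (x n)) (A (x n)))); near=> m.
  have Nm : (N <= m)%N by near: m; exact: nbhs_infty_ge.
  have -> : series (fun k => ip (A (x n)) (b k) * ip (A (x n)) (b k)) m =
      \sum_(N <= j < m) ip (A (x n)) (b j) ^+ 2 + S.
    rewrite /series/= (big_cat_nat (leq0n N) Nm)//= addrC.
    by congr (_ + _); apply: eq_bigr => k _; rewrite expr2.
  rewrite lerD2r (@le_trans _ _ (\sum_(N <= k < m) `|A (b k)| ^+ 2))//.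
    apply: ler_sum => k _; rewrite Asym -[leLHS]real_normK ?num_real//.
    rewrite lerXn2r ?nnegrE// (le_trans (ip_le_norm Hnorm _ _))//.
    by rewrite ler_piMl.
  rewrite lerBrDr.
  have := nondecreasing_cvgn_le _ hs m.
  rewrite /series/= (big_cat_nat (leq0n N) Nm)//= addrC; apply.
  by apply/nondecreasing_series => k _ _; exact: sqr_ge0.
(* The Cauchy criterion asks only for a centre depending on [eps]; the limits of the first N
   coefficients provide it. *)
pose y := \sum_(0 <= j < N) lim (c n j @[n --> U]) *: b j.
exists y.
have cy : \sum_(0 <= j < N) c n j *: b j @[n --> U] --> y.
  apply: (cvg_sum_near (F := U) (f := fun j n => c n j *: b j)) => j.
  by apply: cvgZ; [exact: cc|exact: cvg_cst].
move/cvgrPdist_lt : cy => /(_ _ eps2); apply: filterS => n yn.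
rewrite -ball_normE /=; set s := \sum_(_ <= _ < _) _ in yn tail.
have -> : y - A (x n) = (y - s) - (A (x n) - s) by rewrite opprB addrA subrK.
by rewrite (le_lt_trans (ler_normB _ _))// (splitr eps) ltrD// tail.
Unshelve. all: by end_near. Qed.

(* A maximizing sequence for |A x| over the unit vectors of E^perp satisfies
   A (A x_n) - m^2 x_n -> 0, so by compactness m^2 is an eigenvalue of A^2,
   and A^2 - m^2 = (A - m)(A + m). *)
Lemma eigenvectors_abound_compact : eigenvectors_abound A.
Proof.
have [bA Asym] := sA; have [lA [M M0 AM]] := (bounded_opP A).1 bA; have [_ cA] := bA.
move=> E Ee w w0 Ew.
have AE z : orthogonal_to E z -> orthogonal_to E (A z).
  by move=> Ez y Ey; rewrite Asym; have [l ->] := Ee _ Ey; rewrite ipZr Ez// mulr0.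
have ZE (a : R) z : orthogonal_to E z -> orthogonal_to E (a *: z).
  by move=> Ez y Ey; rewrite ipZl Ez// mulr0.
have DE z t : orthogonal_to E z -> orthogonal_to E t -> orthogonal_to E (z + t).
  by move=> Ez Et y Ey; rewrite ipDl Ez// Et// addr0.
have unitN z : z != 0 -> `| `|z|^-1 *: z| = 1.
  by move=> z0; rewrite normrZ normfV normr_id mulVf// normr_eq0.
pose S := [set s : R | exists x, [/\ `|x| = 1, orthogonal_to E x & s = `|A x| ]].
have S0 : S !=set0.
  by exists `|A (`|w|^-1 *: w)|, (`|w|^-1 *: w); split; [exact: unitN|exact: ZE|].
have SM : ubound S M by move=> _ [x [x1 _ ->]]; have := AM x; rewrite x1 mulr1.
have supS : has_sup S by split=> //; exists M.
set m := sup S.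
have Am x : orthogonal_to E x -> `|A x| <= m * `|x|.
  move=> Ex; have [->|x0] := eqVneq x 0.
    by rewrite (linearop0 lA) normr0 mulr0.
  have : `|A (`|x|^-1 *: x)| <= m.
    apply: (sup_upper_bound supS); exists (`|x|^-1 *: x).
    by split; [exact: unitN|exact: ZE|].
  rewrite (linearopZ lA) normrZ normfV normr_id mulrC ler_pdivrMr//.
  by rewrite normr_gt0.
have m0 : 0 <= m.
  have [s [x [x1 Ex _]]] := S0.
  by rewrite (le_trans (normr_ge0 (A x)))// -[m]mulr1 -x1 Am.
(* If m = 0 then [A] vanishes on the orthogonal complement of [E], and w itself is an eigenvector
   for 0. *)
have [m_eq0|m_neq0] := eqVneq m 0.
  exists w; split=> //; exists 0; rewrite scale0r; apply/eqP.
  by rewrite -normr_le0 (le_trans (Am w Ew))// m_eq0 mul0r.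
have m_gt0 : 0 < m by rewrite lt_neqAle eq_sym m_neq0.
have /choice[x xP] n : exists x, [/\ `|x| = 1, orthogonal_to E x & m - n.+1%:R^-1 < `|A x| ].
  have [|s [x [x1 Ex ->]] mx] := @sup_adherent _ S n.+1%:R^-1 _ supS.
    by rewrite invr_gt0.
  by exists x.
have [U [UU ooU]] := @ultraFilterLemma _ \oo _.
have x1 n : `|x n| = 1 by have [] := xP n.
have Ex n : orthogonal_to E (x n) by have [] := xP n.
have Axm : `|A (x n)| @[n --> \oo] --> m.
  apply: (@squeeze_cvgr _ _ _ _ (fun n => m - n.+1%:R^-1) (cst m)).
  - apply: nearW => n; have [_ _ mx] := xP n; rewrite (ltW mx)/=.
    by rewrite (le_trans (Am _ (Ex n)))// x1 mulr1.
  - by rewrite -[X in _ --> X]subr0; apply: cvgB; [exact: cvg_cst|exact: cvg_harmonic].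
  - exact: cvg_cst.
(* Expanding the square and using |A A x| <= m |A x| gives |A A x - m^2 x|^2 <= m^2 (m^2 - |A x|^2)
   for unit x. *)
have AAx : A (A (x n)) - m ^+ 2 *: x n @[n --> \oo] --> (0 : H).
  have h : m ^+ 2 * (m ^+ 2 - `|A (x n)| ^+ 2) @[n --> \oo] --> (0 : R).
    have -> : 0 = m ^+ 2 * (m ^+ 2 - m ^+ 2) by rewrite subrr mulr0.
    apply: cvgM; first exact: cvg_cst.
    by apply: cvgB; [exact: cvg_cst|rewrite expr2; exact: cvgM].
  apply/cvgr0Pnorm_lt => eps eps0.
  move/cvgr0Pnorm_lt : h => /(_ (eps ^+ 2)); rewrite exprn_gt0// => /(_ isT).
  apply: filterS => n hn; rewrite -(@ltr_pXn2r _ 2)// ?nnegrE ?(ltW eps0)//.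
  apply: le_lt_trans hn; apply: le_trans (ler_norm _).
  rewrite (normB_sq Hnorm) ipZr Asym (ipxx Hnorm) normrZ x1 mulr1.
  rewrite real_normK ?num_real//.
  have : `|A (A (x n))| ^+ 2 <= m ^+ 2 * `|A (x n)| ^+ 2.
    rewrite -exprMn lerXn2r ?nnegrE// ?mulr_ge0//; exact/Am/AE.
  by move=> {xP x1 Ex Axm}; nra.
have /cvg_ex[y Axy] : cvg (A (x n) @[n --> U]).
  by apply: cvg_image_bounded => n; rewrite x1.
(* Compactness controls only the images [A (x n)]; the sequence itself is recovered from
   [A (A (x n))], from which m^2 x_n differs by a null sequence. *)
have xy : x n @[n --> U] --> m ^- 2 *: A y.
  have -> : m ^- 2 *: A y = m ^- 2 *: (A y - 0) by rewrite subr0.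
  have -> : x = fun n => m ^- 2 *: (A (A (x n)) - (A (A (x n)) - m ^+ 2 *: x n)).
    apply/funext => n; rewrite opprB addrC subrK scalerA mulVf ?scale1r//.
    by rewrite expf_neq0.
  apply: cvgZ; first exact: cvg_cst.
  apply: cvgB; first by apply: continuous_cvg; [exact: cA|].
  by move=> V /AAx; exact: ooU.
set v := m ^- 2 *: A y in xy.
have v1 : `|v| = 1.
  apply: (norm_cvg_unique (cvg_norm xy)).
  by apply: cvg_near_cst; apply: nearW => n; exact: x1.
have Ev : orthogonal_to E v.
  move=> z Ez; apply: (norm_cvg_unique (cvg_ipl Hnorm (z := z) xy)).
  by apply: cvg_near_cst; apply: nearW => n; exact: Ex.
have yE : y = A v.
  by apply: (norm_cvg_unique Axy); apply: continuous_cvg; [exact: cA|].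
have AAv : A (A v) = m ^+ 2 *: v.
  by rewrite -yE /v scalerA mulfV ?scale1r// expf_neq0.
clearbody v; have v0 : v != 0 by rewrite -normr_gt0 v1.
(* Since (A - m)(A + m) v = 0, either v is an eigenvector for -m or (A + m) v is one for m. *)
have [u0|u0] := eqVneq (A v + m *: v) 0.
  exists v; split=> //; exists (- m).
  by rewrite scaleNr; apply/eqP; rewrite -addr_eq0 u0.
exists (A v + m *: v); split=> //; first by apply: DE; [exact: AE|exact: ZE].
by exists m; rewrite (linearopD lA) (linearopZ lA m v) AAv scalerDr scalerA -expr2 addrC.
Qed.

Lemma compact_eigenbasis : separable H -> infinite_dimensional H ->
  exists (e : nat -> H) (l : nat -> R),
    orthonormal_basis ip e /\ forall k, A (e k) = l k *: e k.
Proof.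
move=> Hsep Hdim; apply: exists_eigenbasis => //.
- by case: sA.
- exact: eigenvectors_abound_compact.
Qed.

End Compact.
End Spectral.

(** * Functions of diagonalizable operators *)

Section FunctionalCalculus.
Context (R : realType) (H : completeNormedModType R) (ip : {dot H for @idfun R}).
Context (Hnorm : hilbert_norm ip).
Implicit Types (x y z : H) (T A L : H -> H).

Lemma bounded_op_comp T A : bounded_op T -> bounded_op A -> bounded_op (T \o A).
Proof.
move=> [lT cT] [lA cA]; split=> [a x y|x] /=; first by rewrite lA lT.
by apply: continuous_comp; [exact: cA|exact: cT].
Qed.

Lemma bounded_opD T A : bounded_op T -> bounded_op A ->
  bounded_op (fun x => T x + A x).
Proof.
move=> [lT cT] [lA cA]; split=> [a x y|x].
  by rewrite lA lT scalerDr addrACA.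
by apply: cvgD; [exact: cT|exact: cA].
Qed.

Lemma bounded_opZ (c : R) T : bounded_op T -> bounded_op (fun x => c *: T x).
Proof.
move=> [lT cT]; split=> [a x y|x].
  by rewrite lT scalerDr !scalerA mulrC.
by apply: cvgZ; [exact: cvg_cst|exact: cT].
Qed.

Lemma bounded_op_id : bounded_op (@id H).
Proof. by split=> [a x y //|x]; exact: cvg_id. Qed.

Lemma selfadjointD T A : selfadjoint ip T -> selfadjoint ip A ->
  selfadjoint ip (fun x => T x + A x).
Proof.
move=> [bT sT] [bA sA]; split; first exact: bounded_opD.
by move=> x y; rewrite ipDl ipDr sT sA.
Qed.

Lemma selfadjointZ (c : R) T : selfadjoint ip T -> selfadjoint ip (fun x => c *: T x).
Proof.
move=> [bT sT]; split; first exact: bounded_opZ.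
by move=> x y; rewrite ipZl ipZr sT.
Qed.

Lemma selfadjoint_id : selfadjoint ip (@id H).
Proof. by split=> //; exact: bounded_op_id. Qed.

(** The chosen operator may come from another eigenbasis e' with eigenvalues l'. Comparing
    coefficients of T e_k gives (l'_j - l_k) <e_k, e'_j> = 0, so wherever the coefficient is nonzero
    the eigenvalues agree, and so do their images under [f]. *)
Lemma spectral_calculus_eigen (f : R -> R) T e l (M : R) :
  bounded_op T -> orthonormal_basis ip e -> (forall k, T (e k) = l k *: e k) ->
  (forall k, `|f (l k)| <= M) ->
  bounded_op (spectral_calculus ip f T) /\
  forall k, spectral_calculus ip f T (e k) = f (l k) *: e k.
Proof.
move=> bT he Te fM; rewrite /spectral_calculus; case: xgetP => [S -> [bS]|none].
  move=> [e' [l' [he' Te' Se']]]; split=> // k; apply: (coef_inj he') => j.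
  rewrite (ip_eigen Hnorm he' bS Se') ipZl.
  have := ip_eigen Hnorm he' bT Te' (e k) j; rewrite Te ipZl => /eqP.
  rewrite -subr_eq0 -mulrBl mulf_eq0 subr_eq0 => /orP[/eqP->//|/eqP->].
  by rewrite !mulr0.
have := none (diag ip e (f \o l)); case; split.
  exact: (bounded_op_diag Hnorm he fM).
by exists e, l; split=> // k; exact: (diag_basis Hnorm he fM).
Qed.

(** At each x the exponential series is dominated by |x| M^n / n!. Its j-th coefficient is the
    scalar series of exp (l_j) times that of x. *)
Lemma op_exp_eigen L e l : bounded_op L -> orthonormal_basis ip e ->
  (forall k, L (e k) = l k *: e k) ->
  bounded_op (op_exp L) /\ forall k, op_exp L (e k) = expR (l k) *: e k.
Proof.
move=> bL he Le; have [_ [M M0 LM]] := (bounded_opP L).1 bL.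
have lM k : `|l k| <= M.
  have := LM (e k).
  by rewrite Le normrZ (orthonormal_norm Hnorm (basis_orthonormal he)) !mulr1.
have expM k : `|(expR \o l) k| <= expR M.
  by rewrite /= ger0_norm ?expR_ge0// ler_expR (le_trans (ler_norm _)).
have iterM n x : `|iter n L x| <= M ^+ n * `|x|.
  elim: n => [|n IH]; first by rewrite expr0 mul1r.
  by rewrite iterS exprS -mulrA (le_trans (LM _))// ler_wpM2l.
have cv x : cvgn (series (fun n => (n`!%:R)^-1 *: iter n L x)).
  apply: normed_cvg; apply: (@series_le_cvg _ _ (fun n => `|x| * exp_coeff M n)).
  - by move=> n; exact: normr_ge0.
  - by move=> n; rewrite mulr_ge0// exp_coeff_ge0.
  - move=> n /=; rewrite normrZ ger0_norm ?invr_ge0// /exp_coeff/=.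
    by rewrite mulrA [leRHS]mulrC ler_wpM2l ?invr_ge0// mulrC.
  - by apply: is_cvg_seriesZ; exact: is_cvg_series_exp_coeff.
have iter_coef n x j : ip (iter n L x) (e j) = l j ^+ n * ip x (e j).
  elim: n => [|n IH]; first by rewrite expr0 mul1r.
  by rewrite iterS (ip_eigen Hnorm he bL Le) IH exprS mulrA.
suff -> : op_exp L = diag ip e (expR \o l).
  split; first exact: (bounded_op_diag Hnorm he expM).
  exact: (diag_basis Hnorm he expM).
apply/funext => x; apply: (coef_inj he) => j; rewrite (ip_diag Hnorm he expM)/=.
apply: (norm_cvg_unique (cvg_ipl Hnorm (z := e j) (cv x))) => /=.
pose c n := series (exp_coeff (l j)) n * ip x (e j).
have -> : (fun n => ip (series (fun n => (n`!%:R)^-1 *: iter n L x) n) (e j)) = c.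
  apply/funext => n; rewrite /c ip_suml /series/= mulr_suml.
  apply: eq_bigr => k _.
  by rewrite ipZl iter_coef /exp_coeff/= mulrA (mulrC (l j ^+ k)).
by apply: cvgM; [exact: is_cvg_series_exp_coeff|exact: cvg_cst].
Qed.

Lemma norm_ln_le (a b x : R) : 0 < a -> a <= x <= b -> `|ln x| <= `|ln a| + `|ln b|.
Proof.
move=> a0 /andP[ax xb]; have x0 := lt_le_trans a0 ax; have b0 := lt_le_trans x0 xb.
have h1 : ln a <= ln x by rewrite ler_ln ?posrE.
have h2 : ln x <= ln b by rewrite ler_ln ?posrE.
rewrite ler_norml; have := ler_norm (ln b); have := ler_norm (- ln a).
by rewrite normrN; have := normr_ge0 (ln a); have := normr_ge0 (ln b); lra.
Qed.

Section Power.
Context (P : H -> H) (e : nat -> H) (l : nat -> R) (m M : R).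
Context (bP : bounded_op P) (he : orthonormal_basis ip e).
Context (Pe : forall k, P (e k) = l k *: e k) (m0 : 0 < m)
  (mlM : forall k, m <= l k <= M).

Lemma op_log_eigen : bounded_op (op_log ip P) /\
  forall k, op_log ip P (e k) = ln (l k) *: e k.
Proof.
apply: (spectral_calculus_eigen bP he Pe (M := `|ln m| + `|ln M|)) => k.
exact: norm_ln_le.
Qed.

Lemma op_pow_eigen s : bounded_op (op_pow ip P s) /\
  forall k, op_pow ip P s (e k) = l k `^ s *: e k.
Proof.
have [bL Le] := op_log_eigen.
have [||bE Ee] := @op_exp_eigen (fun x => s *: op_log ip P x) e (fun k => s * ln (l k)) _ he.
- exact: bounded_opZ.
- by move=> k; rewrite Le scalerA.
split=> // k; rewrite /op_pow Ee /powR gt_eqF//.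
by have /andP[/(lt_le_trans m0)] := mlM k.
Qed.

End Power.

Section BasisIndependence.
Context (e f : nat -> H) (he : orthonormal_basis ip e) (hf : orthonormal_basis ip f).

(** Both sides are the double sum of <A e_k, f_j>^2 = <e_k, A f_j>^2, and nonnegative terms may be
    summed in either order. *)
Lemma hs_sum_basis A : selfadjoint ip A ->
  (\sum_(0 <= k <oo) (`|A (e k)| ^+ 2)%:E = \sum_(0 <= k <oo) (`|A (f k)| ^+ 2)%:E)%E.
Proof.
move=> [_ sA].
under eq_eseriesr do rewrite -(parseval_sq Hnorm hf).
rewrite nneseries_interchange; last by move=> i j; rewrite lee_fin sqr_ge0.
apply: eq_eseriesr => j _; rewrite -(parseval_sq Hnorm he).
by apply: eq_eseriesr => k _; rewrite sA ipC.
Qed.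

(** Expanding <f_k, P f_k> in the eigenbasis gives the double series of p_j <f_k, e_j>^2; summing
    over k first leaves p_j |e_j|^2 = p_j. *)
Lemma trace_basis P p : bounded_op P -> (forall k, P (e k) = p k *: e k) ->
  (forall k, 0 <= p k) ->
  (\sum_(0 <= k <oo) (ip (f k) (P (f k)))%:E = \sum_(0 <= k <oo) (p k)%:E)%E.
Proof.
move=> bP Pe p0.
have p0' i j : (0 <= (p j * (ip (f i) (e j)) ^+ 2)%:E)%E.
  by rewrite lee_fin mulr_ge0// sqr_ge0.
transitivity (\sum_(0 <= k <oo) \sum_(0 <= j <oo) (p j * (ip (f k) (e j)) ^+ 2)%:E)%E.
  apply: eq_eseriesr => k _; apply/esym/cvg_nneseries.
  have := cvg_ip_eigen Hnorm he (f k) (f k) bP Pe; rewrite ipC.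
  by under eq_fun do under eq_fun do rewrite -expr2.
rewrite nneseries_interchange//; apply: eq_eseriesr => j _.
under eq_eseriesr do rewrite EFinM.
rewrite nneseriesZl ?lee_fin//; last by move=> k _; rewrite lee_fin sqr_ge0.
under eq_eseriesr do rewrite ipC.
by rewrite (parseval_sq Hnorm hf) (orthonormal_norm Hnorm (basis_orthonormal he)) expr1n mule1.
Qed.

End BasisIndependence.
End FunctionalCalculus.

(** * The extended norm and determinant *)

Section Extended.
Context (R : realType) (H : completeNormedModType R) (ip : {dot H for @idfun R}).
Context (Hnorm : hilbert_norm ip).
Implicit Types (x y z : H) (T A C : H -> H).
Context (hb : orthonormal_basis ip (onb ip)).
Local Notation b := (onb ip).

Lemma summable_cvg0 (a : nat -> R) : (forall k, 0 <= a k) ->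
  (\sum_(0 <= k <oo) (a k)%:E < +oo)%E -> a @ \oo --> (0 : R).
Proof. by move=> a0 /(summable_cvgn a0)/cvg_series_cvg_0. Qed.

Lemma cvg0_sqr_norm (u : nat -> H) :
  (fun k => `|u k| ^+ 2) @ \oo --> (0 : R) -> u @ \oo --> (0 : H).
Proof.
move=> u0; apply/cvgr0Pnorm_lt => eps eps0.
move/cvgr0Pnorm_lt : u0 => /(_ (eps ^+ 2)); rewrite exprn_gt0// => /(_ isT).
apply: filterS => k hk; rewrite -(@ltr_pXn2r _ 2)// ?nnegrE ?(ltW eps0)//.
by apply: le_lt_trans hk; exact: ler_norm.
Qed.

Lemma hilbert_schmidt_cvg0 A : hilbert_schmidt ip A -> A \o b @ \oo --> (0 : H).
Proof.
move=> [_ hsA]; apply: cvg0_sqr_norm.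
by apply: summable_cvg0 => // k; exact: sqr_ge0.
Qed.

Lemma form_cauchy_schwarz P x y : selfadjoint ip P -> (forall z, 0 <= ip z (P z)) ->
  ip x (P y) ^+ 2 <= ip x (P x) * ip y (P y).
Proof.
move=> [[lP _] sP] P0; apply: quadratic_cauchy_schwarz => // t.
have -> : ip x (P x) - 2 * t * ip x (P y) + t ^+ 2 * ip y (P y) =
    ip (x - t *: y) (P (x - t *: y)).
  rewrite (linearopB lP) (linearopZ lP) !ipBl !ipBr !ipZl !ipZr.
  by rewrite -(sP y x) (ipC ip (P y)); ring.
exact: P0.
Qed.

(** Cauchy-Schwarz for the form <., P .> at x and P x: |P x|^4 <= <x, P x> <P x, P P x> <= <x, P x>
    M |P x|^2. *)
Lemma nonneg_norm_sq_le P : selfadjoint ip P -> (forall x, 0 <= ip x (P x)) ->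
  exists2 M : R, 0 <= M & forall x, `|P x| ^+ 2 <= M * ip x (P x).
Proof.
move=> saP P0; have [bP sP] := saP; have [_ [M M0 PM]] := (bounded_opP P).1 bP.
exists M => // x; have [->|Px0] := eqVneq (P x) 0.
  by rewrite normr0 expr0n ip0r mulr0.
have h : ip (P x) (P x) ^+ 2 <= ip x (P x) * ip (P x) (P (P x)).
  by rewrite {1}sP; apply: form_cauchy_schwarz.
have n0 : 0 < `|P x| ^+ 2 by rewrite exprn_gt0// normr_gt0.
have h2 : ip (P x) (P (P x)) <= M * `|P x| ^+ 2.
  rewrite (le_trans (ler_norm _))// (le_trans (ip_le_norm Hnorm _ _))//.
  by rewrite expr2 mulrA (mulrC M) -mulrA ler_wpM2l// mulrC.
move: h; rewrite (ipxx Hnorm) => h.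
rewrite -(ler_pM2r n0) -expr2 (le_trans h)// (mulrC M) -mulrA ler_wpM2l//.
Qed.

(** With P = |C| one has |C b_k| = |P b_k|, and |P b_k|^2 is at most a constant times the summable
    <b_k, P b_k>. *)
Lemma trace_class_cvg0 C : trace_class ip C -> C \o b @ \oo --> (0 : H).
Proof.
move=> [_ [P [sP P0 PC]] trP]; have [M M0 PM] := nonneg_norm_sq_le sP P0.
apply: cvg0_sqr_norm; apply: (@squeeze_cvgr _ _ _ _ (cst 0)
  (fun k => M * ip (b k) (P (b k)))).
- apply: nearW => k /=; rewrite sqr_ge0/=.
  by rewrite -(ipxx Hnorm) -PC (ipxx Hnorm) PM.
- exact: cvg_cst.
- have -> : 0 = M * 0 by rewrite mulr0.
  by apply: cvgM; [exact: cvg_cst|exact: summable_cvg0].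
Qed.

(** Along the basis A b_k - C b_k tends to 0, yet its norm is |c - a| for every k. This is what
    determines the choices made in [ehs_norm] and [detX]. *)
Lemma add_scalar_unique A C (a c : R) :
  A \o b @ \oo --> (0 : H) -> C \o b @ \oo --> (0 : H) ->
  add_scalar A a = add_scalar C c -> A = C /\ a = c.
Proof.
move=> A0 C0 AC.
have E x : A x - C x = (c - a) *: x.
  have h : A x + a *: x = C x + c *: x := congr1 (fun f => f x) AC.
  by rewrite scalerBl -[A x](addrK (a *: x)) h addrAC (addrC (C x)) addrK.
suff ac : a = c.
  split=> //; apply/funext => x; apply/eqP; rewrite -subr_eq0 E ac subrr scale0r//.
apply/eqP; rewrite eq_sym -subr_eq0 -normr_eq0; apply/eqP.
have h : (A (b k) - C (b k)) @[k --> \oo] --> (0 : H).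
  by rewrite -[X in _ --> X](subrr 0); apply: cvgB.
move/cvg_norm : h; rewrite normr0; apply: norm_cvg_unique.
apply: cvg_near_cst; apply: nearW => k.
by rewrite E normrZ (orthonormal_norm Hnorm (basis_orthonormal hb)) mulr1.
Qed.

Lemma ehs_norm_add_scalar A c : hilbert_schmidt ip A ->
  ehs_norm ip (add_scalar A c) = Num.sqrt (hs_norm ip A ^+ 2 + c ^+ 2).
Proof.
move=> hA; rewrite /ehs_norm; case: xgetP => [d -> [A' [c' [hA' AA' ->]]]|none].
  by have [-> ->] := add_scalar_unique (hilbert_schmidt_cvg0 hA) (hilbert_schmidt_cvg0 hA') AA'.
by have := none (Num.sqrt (hs_norm ip A ^+ 2 + c ^+ 2)); case; exists A, c.
Qed.

Lemma detX_add_scalar C c : trace_class ip C -> c != 0 ->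
  detX ip (add_scalar C c) = c * fredholm_det ip (fun x => c^-1 *: C x).
Proof.
move=> hC c0; rewrite /detX; case: xgetP => [d -> [C' [c' [hC' _ CC' ->]]]|none].
  by have [-> ->] := add_scalar_unique (trace_class_cvg0 hC) (trace_class_cvg0 hC') CC'.
by have := none (c * fredholm_det ip (fun x => c^-1 *: C x)); case; exists C, c.
Qed.

(* A nonnegative operator is its own absolute value. *)
Lemma trace_class_eigen C e t : bounded_op C -> orthonormal_basis ip e ->
  (forall k, C (e k) = t k *: e k) -> (forall k, 0 <= t k) ->
  cvgn (series t) -> trace_class ip C.
Proof.
move=> bC he Ce t0 tcv; split=> //; exists C; last first.
  rewrite (trace_basis Hnorm he hb bC Ce t0).
  by rewrite (cvg_nneseries tcv) ltry.
split=> //; first exact: (eigen_selfadjoint Hnorm he bC Ce).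
move=> x; rewrite ipC; apply: (cvgr_to_ge (cvg_ip_eigen Hnorm he x x bC Ce)).
by apply: nearW => n; apply: sumr_ge0 => k _; rewrite mulr_ge0// -expr2 sqr_ge0.
Qed.

End Extended.

(** Each of the n! permutation products has square at most the product of d_i d_(s i), which is the
    square of the product of the d_i after reindexing by s. *)
Lemma norm_det_le (R : realDomainType) n (M : 'M[R]_n) (d : 'I_n -> R) :
  (forall i, 0 <= d i) -> (forall i j, M i j ^+ 2 <= d i * d j) ->
  `|\det M| <= n`!%:R * \prod_i d i.
Proof.
move=> d0 Md; rewrite /determinant (le_trans (ler_norm_sum _ _ _))//.
have -> : n`!%:R * \prod_i d i = \sum_(s : 'S_n) \prod_i d i.
  by rewrite sumr_const card_Sn mulr_natl.
apply: ler_sum => s _; rewrite normrM normrX normrN1 expr1n mul1r.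
rewrite -(@ler_pXn2r _ 2)// ?nnegrE ?prodr_ge0//.
rewrite real_normK ?num_real// -prodrXl.
have -> : (\prod_i d i) ^+ 2 = \prod_i (d i * d (s i)).
  by rewrite big_split/= expr2; congr (_ * _); exact: (reindex_inj (@perm_inj _ s)).
by apply: ler_prod => i _; rewrite sqr_ge0 Md.
Qed.

(** * Fredholm's series of a nonnegative operator of finite trace *)

Section Fredholm.
Context (R : realType) (H : completeNormedModType R) (ip : {dot H for @idfun R}).
Local Notation b := (onb ip).
Context (K : H -> H) (tau : R) (sK : selfadjoint ip K)
  (K0 : forall x, 0 <= ip x (K x))
  (trK : (\sum_(0 <= k <oo) (ip (b k) (K (b k)))%:E = tau%:E)%E).

Let d k := ip (b k) (K (b k)).

Lemma cvg_trace : series d @ \oo --> tau.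
Proof.
have cd : cvgn (series d).
  by apply: summable_cvgn => [k|]; [exact: K0|rewrite trK ltry].
by have /eqP := cvg_nneseries cd; rewrite trK eqe => /eqP ->.
Qed.

Lemma trace_partial_le N : \sum_(i < N) d i <= tau.
Proof.
rewrite -(big_mkord xpredT d); have := cvg_trace => cd.
rewrite -(cvg_lim _ cd)//; apply: (@nondecreasing_cvgn_le _ (series d)).
  by apply/nondecreasing_series => k _ _; exact: K0.
by apply/cvg_ex; exists tau.
Qed.

Lemma trace_ge0 : 0 <= tau.
Proof. by have := trace_partial_le 0; rewrite big_ord0. Qed.

Lemma trace_exterior0 : trace_exterior ip K 0 = 1.
Proof.
apply: cvg_lim => //; apply: cvg_near_cst; apply: nearW => N.
under eq_bigr do rewrite det_mx00.
by rewrite sumr_const card_ffun !card_ord expn0 invr1 mul1r.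
Qed.

Lemma trace_exterior1 : trace_exterior ip K 1 = tau.
Proof.
apply: cvg_lim => //.
suff E N : (1`!%:R)^-1 * \sum_(s : {ffun 'I_1 -> 'I_N})
    \det (\matrix_(i < 1, j < 1) ip (b (s i)) (K (b (s j)))) = series d N.
  by under eq_fun do rewrite E; exact: cvg_trace.
under eq_bigr do rewrite det_mx11 mxE.
rewrite invr1 mul1r.
transitivity (\sum_(s : {ffun 'I_1 -> 'I_N}) \prod_i d (s i)).
  by apply: eq_bigr => s _; rewrite big_ord1.
by rewrite -(bigA_distr_bigA (fun _ (j : 'I_N) => d j)) big_ord1 /series/= big_mkord.
Qed.

(* A sequence without limit has [lim] equal to the default point 0, so the
   bound needs no convergence proof. *)
Lemma norm_trace_exterior_le n : `|trace_exterior ip K n| <= tau ^+ n.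
Proof.
rewrite /trace_exterior; set u := fun N : nat => _.
have uN N : `|u N| <= tau ^+ n.
  rewrite /u normrM ger0_norm ?invr_ge0// mulrC ler_pdivrMr ?ltr0n ?fact_gt0//.
  rewrite (le_trans (ler_norm_sum _ _ _))//.
  apply: (@le_trans _ _ (\sum_(s : {ffun 'I_n -> 'I_N}) n`!%:R * \prod_i d (s i))).
    apply: ler_sum => s _; apply: norm_det_le => [i|i j]; first exact: K0.
    by rewrite mxE; exact: form_cauchy_schwarz.
  (* Summed over all index maps, the products of diagonal entries factor into the n-th power of a
     partial trace; the n! is absorbed by the normalization. *)
  rewrite -mulr_sumr mulrC ler_wpM2r// -(bigA_distr_bigA (fun _ (j : 'I_N) => d j)).
  rewrite prodr_const card_ord lerXn2r ?nnegrE ?trace_ge0 ?trace_partial_le//.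
  by apply: sumr_ge0 => i _; exact: K0.
have [cu|/dvgP->] := pselect (cvgn u).
  rewrite ler_norml; apply/andP; split.
    by apply: limr_ge => //; apply: nearW => N; have := uN N; rewrite ler_norml => /andP[].
  by apply: limr_le => //; apply: nearW => N; have := uN N; rewrite ler_norml => /andP[].
by rewrite normr0 exprn_ge0// trace_ge0.
Qed.

(** The terms of order 0 and 1 are 1 and tau; from order 2 on, the series is dominated by a
    geometric one of ratio at most 1/2, whose sum is at most 2 tau^2. *)
Lemma fredholm_det_approx : tau <= 2^-1 ->
  `|fredholm_det ip K - 1 - tau| <= 2 * tau ^+ 2.
Proof.
move=> tau2; have t0 := trace_ge0.
have cv : cvgn (series (trace_exterior ip K)).
  apply: normed_cvg; apply: (@series_le_cvg _ _ (fun n => tau ^+ n)).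
  - by move=> n; exact: normr_ge0.
  - by move=> n; exact: exprn_ge0.
  - by move=> n; exact: norm_trace_exterior_le.
  - have := @is_cvg_geometric_series _ 1 tau; rewrite ger0_norm//.
    have h : tau < 1 by apply: le_lt_trans tau2 _; rewrite invf_lt1// ltr1n.
    by move=> /(_ h); congr (cvgn (series _)); apply/funext => n /=; rewrite mul1r.
(* The subtracted term makes the induction close: it costs exactly 2 tau <= 1. *)
have tail N : \sum_(2 <= n < N.+2) tau ^+ n <= 2 * tau ^+ 2 - 2 * tau ^+ N.+2.
  elim: N => [|N IH]; first by rewrite big_geq// subrr.
  rewrite big_nat_recr//= (le_trans (lerD IH (lexx _)))//.
  rewrite [tau ^+ N.+3]exprS.
  have : 0 <= tau ^+ N.+2 by exact: exprn_ge0.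
  by nra.
have bd N : `|series (trace_exterior ip K) N.+2 - 1 - tau| <= 2 * tau ^+ 2.
  rewrite /series/= big_ltn// big_ltn// trace_exterior0 trace_exterior1.
  have -> (s : R) : 1 + (tau + s) - 1 - tau = s by ring.
  rewrite (le_trans (ler_norm_sum _ _ _))//.
  apply: (@le_trans _ _ (\sum_(2 <= n < N.+2) tau ^+ n)).
    by apply: ler_sum => n _; exact: norm_trace_exterior_le.
  rewrite (le_trans (tail N))// gerBl mulr_ge0//.
  by rewrite exprn_ge0.
apply: (cvgr_to_le (f := fun N => `|series (trace_exterior ip K) N - 1 - tau|)
  (F := \oo)).
  by apply: cvg_norm; apply: cvgB; [apply: cvgB => //; exact: cvg_cst|exact: cvg_cst].
near=> N; have -> : N = N.-2.+2 by rewrite -subn2 -addn2 subnK//; near: N; exact: nbhs_infty_ge.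
exact: bd.
Unshelve. all: by end_near. Qed.

End Fredholm.

(** * Second-order expansion of the eigenvalues *)

Section Scalar.
Context (R : realType).
Implicit Types (u y r d : R).

(** From order 3 on, |u|^n / n! <= |u|^3 / n!, and the reciprocal factorials sum to at most
    [expR 1]. *)
Lemma expR_taylor2 u : `|u| <= 1 ->
  `|expR u - 1 - u - u ^+ 2 / 2| <= expR 1 * `|u| ^+ 3.
Proof.
move=> u1.
have cv := is_cvg_series_exp_coeff u.
apply: (cvgr_to_le (f := fun N => `|series (exp_coeff u) N - 1 - u - u ^+ 2 / 2|)
  (F := \oo)).
  apply: cvg_norm; apply: cvgB; last exact: cvg_cst.
  by apply: cvgB; [apply: cvgB => //; exact: cvg_cst|exact: cvg_cst].
near=> N; have N3 : (3 <= N)%N by near: N; exact: nbhs_infty_ge.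
rewrite /series/= big_ltn ?(leq_trans _ N3)// big_ltn ?(leq_trans _ N3)//.
rewrite big_ltn ?(leq_trans _ N3)// /exp_coeff/= expr0 expr1 !divr1.
have -> (s : R) : 1 + (u + (u ^+ 2 / 2`!%:R + s)) - 1 - u - u ^+ 2 / 2 = s.
  by rewrite (_ : 2`! = 2)%N//; ring.
rewrite (le_trans (ler_norm_sum _ _ _))//.
apply: (@le_trans _ _ (\sum_(0 <= n < N) exp_coeff 1 n * `|u| ^+ 3)).
  rewrite [leRHS](big_cat_nat (leq0n 3) N3)/= -[leLHS]add0r lerD//.
    by apply: sumr_ge0 => n _; rewrite mulr_ge0 ?exp_coeff_ge0// exprn_ge0.
  rewrite !big_nat; apply: ler_sum => n /andP[n3 _].
  rewrite normrM normrX normfV normr_nat /exp_coeff/= expr1n mul1r mulrC.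
  by rewrite ler_wpM2l ?invr_ge0// ler_wiXn2l.
rewrite -mulr_suml ler_wpM2r ?exprn_ge0//.
apply: (@nondecreasing_cvgn_le _ (series (exp_coeff 1))).
  by apply/nondecreasing_series => n _ _; exact: exp_coeff_ge0.
exact: is_cvg_series_exp_coeff.
Unshelve. all: by end_near. Qed.

(* With weight d = c^r / (c^r + 1) at x = c exp(y), this is g(x) / g(c) - 1 for
   g(x) = (x^{r(1-d)} + x^{-rd}) / 2; the choice of d makes c the minimum of g. *)
Definition divergence_density d r y :=
  d * expR (r * (1 - d) * y) + (1 - d) * expR (- (r * d) * y) - 1.

(** Apply exp x >= 1 + x to both exponentials: with weights d and 1 - d the linear terms cancel. *)
Lemma divergence_density_ge0 d r y : 0 <= d <= 1 -> 0 <= divergence_density d r y.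
Proof.
move=> /andP[d0 d1]; rewrite /divergence_density.
have h1 := expR_ge1Dx (r * (1 - d) * y).
have h2 := expR_ge1Dx (- (r * d) * y).
have h3 : d * (1 + r * (1 - d) * y) <= d * expR (r * (1 - d) * y) by rewrite ler_wpM2l.
have h4 : (1 - d) * (1 + - (r * d) * y) <= (1 - d) * expR (- (r * d) * y).
  by rewrite ler_wpM2l// subr_ge0.
by nra.
Qed.

(** Taylor expansion of both exponentials: the linear terms cancel, and the quadratic ones combine
    through d (1-d)^2 + (1-d) d^2 = d (1-d). *)
Lemma divergence_density_approx d r y : 0 <= d <= 1 -> `|r * y| <= 1 ->
  `|divergence_density d r y - r ^+ 2 * (d * (1 - d)) / 2 * y ^+ 2| <=
    expR 1 * `|r * y| ^+ 3.
Proof.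
move=> /andP[d0 d1] ry1.
have d1' : 0 <= 1 - d by rewrite subr_ge0.
have small (t : R) : 0 <= t <= 1 -> `|t * (r * y)| <= `|r * y|.
  by move=> /andP[t0 t1]; rewrite normrM ger0_norm// ler_piMl.
have term (t u : R) : 0 <= t -> `|u| <= `|r * y| ->
    `|t * (expR u - 1 - u - u ^+ 2 / 2)| <= t * (expR 1 * `|r * y| ^+ 3).
  move=> t0 uy; rewrite normrM ger0_norm// ler_wpM2l//.
  rewrite (le_trans (expR_taylor2 (le_trans uy ry1)))// ler_wpM2l ?expR_ge0//.
  by rewrite lerXn2r// nnegrE.
have h1 := @term d (r * (1 - d) * y) d0 _.
have h2 := @term (1 - d) (- (r * d) * y) d1' _.
have -> : divergence_density d r y - r ^+ 2 * (d * (1 - d)) / 2 * y ^+ 2 =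
  d * (expR (r * (1 - d) * y) - 1 - r * (1 - d) * y - (r * (1 - d) * y) ^+ 2 / 2) +
  (1 - d) * (expR (- (r * d) * y) - 1 - (- (r * d) * y) - (- (r * d) * y) ^+ 2 / 2).
  by rewrite /divergence_density; field.
rewrite (le_trans (ler_normD _ _))//.
have -> : expR 1 * `|r * y| ^+ 3 = d * (expR 1 * `|r * y| ^+ 3) +
  (1 - d) * (expR 1 * `|r * y| ^+ 3) by ring.
apply: lerD; [apply: h1|apply: h2].
  have -> : r * (1 - d) * y = (1 - d) * (r * y) by ring.
  by apply: small; apply/andP; split; lra.
have -> : - (r * d) * y = - (d * (r * y)) by ring.
by rewrite normrN; apply: small; rewrite d0.
Qed.

Section Sum.
Context (y : nat -> R) (Y : R) (yY : forall k, `|y k| <= Y)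
  (ycv : cvgn (series (fun k => y k ^+ 2))).
Local Notation S := (limn (series (fun k => y k ^+ 2))).

(** The uniform bound [Y] trades one factor of |y_k|^3, leaving the summable y_k^2; [|r| * Y <= 1]
    puts all k in the range of the Taylor estimate at once. *)
Lemma divergence_density_term d r k : 0 <= d <= 1 -> `|r| * Y <= 1 ->
  `|divergence_density d r (y k) - r ^+ 2 * (d * (1 - d)) / 2 * y k ^+ 2| <=
    expR 1 * `|r| ^+ 3 * Y * y k ^+ 2.
Proof.
move=> d01 rY.
have ry : `|r * y k| <= 1 by rewrite normrM (le_trans _ rY)// ler_wpM2l.
rewrite (le_trans (divergence_density_approx d01 ry))//.
rewrite normrM exprMn [leLHS]mulrA -[leRHS]mulrA.
rewrite ler_wpM2l ?mulr_ge0 ?expR_ge0 ?exprn_ge0//.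
by rewrite [`|y k| ^+ 3]exprS real_normK ?num_real// ler_wpM2r ?sqr_ge0.
Qed.

Lemma is_cvg_divergence_sum d r : 0 <= d <= 1 -> `|r| * Y <= 1 ->
  cvgn (series (fun k => divergence_density d r (y k))).
Proof.
move=> d01 rY.
pose C := r ^+ 2 * (d * (1 - d)) / 2 + expR 1 * `|r| ^+ 3 * Y.
apply: (@series_le_cvg _ _ (fun k => C * y k ^+ 2)).
- by move=> k; exact: divergence_density_ge0.
- move=> k; rewrite mulr_ge0 ?sqr_ge0// addr_ge0//.
    case/andP: d01 => d0 d1.
    by rewrite divr_ge0// mulr_ge0 ?sqr_ge0// mulr_ge0// subr_ge0.
  have Y0 : 0 <= Y := le_trans (normr_ge0 _) (yY 0%N).
  by rewrite !mulr_ge0 ?expR_ge0 ?exprn_ge0.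
- move=> k; have := divergence_density_term k d01 rY.
  by rewrite ler_distl mulrDl addrC => /andP[].
- exact: is_cvg_seriesZ.
Qed.

Lemma divergence_sum_approx d r : 0 <= d <= 1 -> `|r| * Y <= 1 ->
  `|limn (series (fun k => divergence_density d r (y k))) -
    r ^+ 2 * (d * (1 - d)) / 2 * S| <= expR 1 * `|r| ^+ 3 * Y * S.
Proof.
move=> d01 rY; have cd := is_cvg_divergence_sum d01 rY.
set q := r ^+ 2 * (d * (1 - d)) / 2; set E := expR 1 * `|r| ^+ 3 * Y.
apply: (ler_cvg_to
  (f := fun n => `|series (fun k => divergence_density d r (y k)) n -
     q * series (fun k => y k ^+ 2) n|)
  (g := fun n => E * series (fun k => y k ^+ 2) n) (a := \oo)).
- by apply: cvg_norm; apply: cvgB => //; apply: cvgM => //; exact: cvg_cst.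
- by apply: cvgM => //; exact: cvg_cst.
apply: nearW => n; rewrite /series/= !mulr_sumr -sumrB.
rewrite (le_trans (ler_norm_sum _ _ _))//; apply: ler_sum => k _.
exact: divergence_density_term.
Qed.

End Sum.
End Scalar.

(** * The whitened operator *)

Section Whitening.
Context (R : realType) (H : completeNormedModType R) (ip : {dot H for @idfun R}).
Context (Hnorm : hilbert_norm ip) (Hsep : separable H) (Hdim : infinite_dimensional H).
Implicit Types (x y z : H) (A B T C : H -> H).
Let hb : orthonormal_basis ip (onb ip) := exists_onb Hnorm Hsep Hdim.

Lemma hs_sum_eigen A e a : selfadjoint ip A -> orthonormal_basis ip e ->
  (forall k, A (e k) = a k *: e k) ->
  hs_sum ip A = (\sum_(0 <= k <oo) (a k ^+ 2)%:E)%E.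
Proof.
move=> sA he Ae; rewrite /hs_sum (hs_sum_basis Hnorm hb he sA).
apply: eq_eseriesr => k _; rewrite Ae normrZ exprMn real_normK ?num_real//.
by rewrite (orthonormal_norm Hnorm (basis_orthonormal he)) expr1n mulr1.
Qed.

Lemma PC2_eigen A (c : R) : PC2 ip A c ->
  exists e a m M, [/\ orthonormal_basis ip e, forall k, A (e k) = a k *: e k,
    cvgn (series (fun k => a k ^+ 2)), 0 < m &
    (forall k, m <= a k + c <= M) /\ m <= c].
Proof.
move=> [[bA hsA] sA [_ [m m0 mA]]].
have cvA : cvgn (series (fun k => `|A (onb ip k)| ^+ 2)).
  by apply: summable_cvgn => // k; exact: sqr_ge0.
have [e [a [he Ae]]] := compact_eigenbasis Hnorm sA hb cvA Hsep Hdim.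
have [M aM] := eigen_bounded Hnorm he bA Ae.
have cva : cvgn (series (fun k => a k ^+ 2)).
  by apply: summable_cvgn => [k|]; [exact: sqr_ge0|rewrite -(hs_sum_eigen sA he Ae)].
have ma k : m <= a k + c.
  have := mA (e k); rewrite /add_scalar Ae -scalerDl ipZr (ipxx Hnorm).
  by rewrite (orthonormal_norm Hnorm (basis_orthonormal he)) expr1n !mulr1.
exists e, a, m, (M + c); split=> //; split=> [k|].
  by rewrite ma/= lerD2r (le_trans (ler_norm _)).
(* The bound m <= a_k + c passes to the limit a_k -> 0, which bounds the scalar c itself from
   below. *)
have a0 : a @ \oo --> (0 : R).
  apply/cvgr0Pnorm_lt => eps eps0.
  have /cvgr0Pnorm_lt/(_ (eps ^+ 2)) := cvg_series_cvg_0 cva.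
  rewrite exprn_gt0// => /(_ isT); apply: filterS => k.
  by rewrite normrX ltr_pXn2r// nnegrE// ltW.
have : a k + c @[k --> \oo] --> 0 + c by apply: cvgD => //; exact: cvg_cst.
rewrite add0r => h; apply: (cvgr_to_ge h); exact: nearW.
Qed.

Lemma add_scalar_eigen A (e : nat -> H) (a : nat -> R) (c : R) :
  (forall k, A (e k) = a k *: e k) ->
  forall k, add_scalar A c (e k) = (a k + c) *: e k.
Proof. by move=> Ae k; rewrite /add_scalar Ae scalerDl. Qed.

Lemma bounded_op_add_scalar A (c : R) : bounded_op A -> bounded_op (add_scalar A c).
Proof.
by move=> bA; apply: bounded_opD => //; apply: bounded_opZ; exact: bounded_op_id.
Qed.

Lemma inv_sqrt_sqr (x : R) : 0 < x -> (x `^ (- 2^-1)) ^+ 2 = x^-1.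
Proof.
move=> x0; rewrite expr2 -powRD; last by rewrite (gt_eqF x0) implybT.
have -> : - 2^-1 + - 2^-1 = -1 :> R by lra.
by rewrite powR_inv1// ltW.
Qed.

(** With Q the inverse square root of B + mu I, L = Q A Q + (gamma Q^2 - c I). In the eigenbasis of
    B the bracket is diagonal with entries -gamma b_k / ((b_k + mu) mu), hence square summable, so
    the Hilbert-Schmidt sum of L is estimated in that basis. *)
Lemma whitened_PC2 A (gamma : R) B (mu : R) :
  PC2 ip A gamma -> PC2 ip B mu -> exists L : H -> H,
  PC2 ip L (gamma / mu) /\ whitened ip A gamma B mu = add_scalar L (gamma / mu).
Proof.
move=> PA PB; have [f [bt [m [M [hf Bf cvb m0 [mbM mmu]]]]]] := PC2_eigen PB.
have [[bA hsA] sA [_ [mA mA0 AmA]]] := PA; have [[bB _] _ _] := PB.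
have mu0 : 0 < mu := lt_le_trans m0 mmu.
pose Q := op_pow ip (add_scalar B mu) (- 2^-1).
have [bQ Qf] := op_pow_eigen Hnorm (bounded_op_add_scalar mu bB) hf
  (add_scalar_eigen mu Bf) m0 mbM (- 2^-1).
rewrite -/Q in bQ Qf; set q := fun k => (bt k + mu) `^ (- 2^-1).
have {}Qf k : Q (f k) = q k *: f k by exact: Qf.
have b0 k : 0 < bt k + mu by have /andP[/(lt_le_trans m0)] := mbM k.
have qq k : q k ^+ 2 = (bt k + mu)^-1 by exact: inv_sqrt_sqr.
have q0 k : 0 < q k by rewrite powR_gt0.
have sQ : selfadjoint ip Q by exact: (eigen_selfadjoint Hnorm hf bQ Qf).
have [_ Qsym] := sQ; have [_ Asym] := sA; have [lQ _] := bQ; have [lA _] := bA.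
set c := gamma / mu.
have sQAQ : selfadjoint ip (fun x => Q (A (Q x))).
  split; first by apply: bounded_op_comp => //; exact: bounded_op_comp.
  by move=> x y; rewrite Qsym Asym Qsym.
have sQQ : selfadjoint ip (fun x => Q (Q x)).
  by split; [exact: bounded_op_comp|move=> x y; rewrite !Qsym].
pose L x := Q (A (Q x)) + (gamma *: Q (Q x) + (- c) *: x).
have sL : selfadjoint ip L.
  apply: selfadjointD => //; apply: selfadjointD; first exact: selfadjointZ.
  by apply: selfadjointZ; exact: selfadjoint_id.
have XE : whitened ip A gamma B mu = add_scalar L c.
  apply/funext => x; rewrite /whitened /add_scalar /L /= -/Q.
  rewrite (linearopD lQ) (linearopZ lQ) scaleNr -!addrA; congr (_ + _).
  by rewrite addrA subrK.
exists L; split=> //; split; [split; [by case: sL|]|exact: sL|split].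
- have [_ [MQ MQ0 QM]] := (bounded_opP Q).1 bQ.
  have qM k : q k <= MQ.
    have := QM (f k); rewrite Qf normrZ (orthonormal_norm Hnorm (basis_orthonormal hf)).
    by rewrite !mulr1 ger0_norm// ltW.
  have cvAf : cvgn (series (fun k => `|A (f k)| ^+ 2)).
    apply: summable_cvgn => [k|]; first exact: sqr_ge0.
    by rewrite -(hs_sum_basis Hnorm hb hf sA).
  (* [C1] bounds the two factors Q around A; [C2] uses b_k + mu >= m. The two parts are joined by (s
     + t)^2 <= 2 s^2 + 2 t^2. *)
  pose C1 := MQ ^+ 2; pose C2 := `|gamma| / (m * mu).
  rewrite /hs_sum (hs_sum_basis Hnorm hb hf sL).
  suff cvL : cvgn (series (fun k => `|L (f k)| ^+ 2)).
    by rewrite (cvg_nneseries cvL) ltry.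
  apply: (@series_le_cvg _ _
    (fun k => 2 * C1 ^+ 2 * `|A (f k)| ^+ 2 + 2 * C2 ^+ 2 * bt k ^+ 2)).
  + by move=> k; exact: sqr_ge0.
  + by move=> k; rewrite addr_ge0// mulr_ge0 ?sqr_ge0// mulr_ge0 ?sqr_ge0.
  + move=> k.
    have h1 : `|Q (A (Q (f k)))| <= C1 * `|A (f k)|.
      rewrite Qf (linearopZ lA) (linearopZ lQ) normrZ ger0_norm ?(ltW (q0 k))//.
      by rewrite /C1 expr2 -mulrA ler_pM// ltW.
    have h2 : `|gamma *: Q (Q (f k)) + (- c) *: f k| <= C2 * `|bt k|.
      rewrite Qf (linearopZ lQ) Qf !scalerA -scalerDl normrZ.
      rewrite (orthonormal_norm Hnorm (basis_orthonormal hf)) mulr1.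
      have -> : gamma * q k * q k + - c = gamma / ((bt k + mu) * mu) * - bt k.
        rewrite -mulrA -expr2 qq /c; field.
        by rewrite (gt_eqF mu0) (gt_eqF (b0 k)).
      rewrite normrM normrN ler_wpM2r// /C2 normrM ler_wpM2l//.
      rewrite ger0_norm ?invr_ge0 ?mulr_ge0 ?(ltW mu0) ?(ltW (b0 k))//.
      rewrite lef_pV2 ?posrE ?mulr_gt0// ler_wpM2r ?(ltW mu0)//.
      by have /andP[] := mbM k.
    rewrite (@le_trans _ _ ((C1 * `|A (f k)| + C2 * `|bt k|) ^+ 2))//.
      by rewrite lerXn2r ?nnegrE// ?(le_trans (ler_normD _ _)) ?lerD//
        addr_ge0// (le_trans _ h1, le_trans _ h2).
    have -> : 2 * C1 ^+ 2 * `|A (f k)| ^+ 2 + 2 * C2 ^+ 2 * bt k ^+ 2 =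
        2 * (C1 * `|A (f k)|) ^+ 2 + 2 * (C2 * `|bt k|) ^+ 2.
      by rewrite -[bt k ^+ 2]real_normK ?num_real//; ring.
    set s := C1 * _; set t := C2 * _; rewrite -subr_ge0.
    have -> : 2 * s ^+ 2 + 2 * t ^+ 2 - (s + t) ^+ 2 = (s - t) ^+ 2 by ring.
    exact: sqr_ge0.
  + have h1 := @is_cvg_seriesZ _ _ (2 * C1 ^+ 2) cvAf.
    have h2 := @is_cvg_seriesZ _ _ (2 * C2 ^+ 2) cvb.
    exact: is_cvg_seriesD.
- rewrite -XE; split.
    apply: bounded_op_comp => //; apply: bounded_op_comp => //.
    exact: bounded_op_add_scalar.
  move=> x y; rewrite /whitened /add_scalar /= -/Q Qsym -[RHS]Qsym.
  by rewrite ipDl ipDr ipZl ipZr Asym.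
- have M0 : 0 < M.
    by have /andP[_] := mbM 0%N; apply: lt_le_trans.
  (* Since b_k + mu <= M, the eigenvalues of Q^2 are at least 1 / M, so |Q x|^2 >= |x|^2 / M. *)
  exists (mA / M); first by rewrite divr_gt0.
  move=> x; rewrite -XE /whitened /= -/Q -Qsym.
  apply: le_trans (AmA (Q x)); rewrite -mulrA ler_wpM2l ?(ltW mA0)//.
  rewrite mulrC ler_pdivrMr// mulrC -[M in leRHS]sqr_sqrtr ?(ltW M0)// -exprMn.
  rewrite lerXn2r ?nnegrE ?mulr_ge0 ?sqrtr_ge0//.
  apply: (norm_le_coef Hnorm hf) => [|k]; first exact: sqrtr_ge0.
  rewrite (ip_eigen Hnorm hf bQ Qf) normrM mulrA ler_peMl// ger0_norm ?(ltW (q0 k))//.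
  rewrite -(@ler_pXn2r _ 2)// ?nnegrE ?mulr_ge0 ?sqrtr_ge0 ?(ltW (q0 k))//.
  rewrite expr1n exprMn sqr_sqrtr ?(ltW M0)// qq ler_pdivlMr// mul1r.
  by have /andP[] := mbM k.
Qed.

End Whitening.

(** Apply ln (1 + z) <= z to the quotient s / t, in both orders. It turns square summability of the
    eigenvalues of L into that of the log ratios. *)
Lemma ln_sub_le (R : realType) (m x c : R) : 0 < m -> m <= x -> m <= c ->
  `|ln x - ln c| <= `|x - c| / m.
Proof.
move=> m0 mx mc; have x0 := lt_le_trans m0 mx; have c0 := lt_le_trans m0 mc.
have key (s t : R) : 0 < s -> m <= t -> ln s - ln t <= `|s - t| / m.
  move=> s0 mt; have t0 := lt_le_trans m0 mt.
  rewrite -ln_div ?posrE// (_ : s / t = 1 + (s - t) / t); last first.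
    by field; rewrite gt_eqF.
  apply: le_trans (le_ln1Dx _) _.
    rewrite mulrBl mulfV ?gt_eqF// ltrBrDr addrC subrr.
    exact: divr_gt0.
  apply: (@le_trans _ _ (`|s - t| / t)).
    by rewrite ler_wpM2r ?ler_norm// invr_ge0 ltW.
  by rewrite ler_wpM2l// lef_pV2.
rewrite ler_norml; apply/andP; split; last exact: key.
by rewrite lerNl opprB distrC; exact: key.
Qed.

(** * The divergence and the distance in terms of eigenvalues *)

Section Divergence.
Context (R : realType) (H : completeNormedModType R) (ip : {dot H for @idfun R}).
Context (Hnorm : hilbert_norm ip) (Hsep : separable H) (Hdim : infinite_dimensional H).
Context (A B : H -> H) (gamma mu : R) (HA : PC2 ip A gamma) (HB : PC2 ip B mu).
Let hb : orthonormal_basis ip (onb ip) := exists_onb Hnorm Hsep Hdim.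
Local Notation X := (whitened ip A gamma B mu).
Local Notation c := (gamma / mu).

Lemma PC2_scalar_gt0 T (t : R) : PC2 ip T t -> 0 < t.
Proof.
move=> /(PC2_eigen Hnorm Hsep Hdim)[e [a [m [M [_ _ _ m0 [_]]]]]].
exact: lt_le_trans.
Qed.

Lemma whitened_eigen : exists (e : nat -> H) (x : nat -> R) (m M : R),
  [/\ bounded_op X, orthonormal_basis ip e, forall k, X (e k) = x k *: e k,
    0 < m /\ (forall k, m <= x k <= M) &
    exists Y, (forall k, `|ln (x k) - ln c| <= Y) /\
      cvgn (series (fun k => (ln (x k) - ln c) ^+ 2))].
Proof.
have [L [PL XE]] := whitened_PC2 Hnorm Hsep Hdim HA HB.
have [e [a [m [M [he Le cva m0 [maM mc]]]]]] := PC2_eigen Hnorm Hsep Hdim PL.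
have [[bL _] _ _] := PL.
have ya k : `|ln (a k + c) - ln c| <= `|a k| / m.
  have /andP[ma _] := maM k.
  by rewrite (le_trans (ln_sub_le m0 ma mc))// addrK.
have [Ma aMa] := eigen_bounded Hnorm he bL Le.
exists e, (fun k => a k + c), m, M; split=> //.
- by rewrite XE; exact: bounded_op_add_scalar.
- by rewrite XE; exact: add_scalar_eigen.
exists (Ma / m); split=> [k|].
  by rewrite (le_trans (ya k))// ler_wpM2r// invr_ge0 ltW.
apply: (@series_le_cvg _ _ (fun k => m^-1 ^+ 2 * a k ^+ 2)).
- by move=> k; exact: sqr_ge0.
- by move=> k; rewrite mulr_ge0 ?sqr_ge0.
- move=> k; rewrite -[leLHS]real_normK ?num_real// -[a k ^+ 2]real_normK ?num_real//.
  rewrite -exprMn lerXn2r ?nnegrE ?mulr_ge0 ?invr_ge0 ?(ltW m0)//.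
  by rewrite [leRHS]mulrC; exact: ya.
- exact: is_cvg_seriesZ.
Qed.

Section Eigen.
Context (e : nat -> H) (x : nat -> R) (m M Y : R) (bX : bounded_op X)
  (he : orthonormal_basis ip e) (Xe : forall k, X (e k) = x k *: e k)
  (m0 : 0 < m) (mxM : forall k, m <= x k <= M).
Local Notation y := (fun k => ln (x k) - ln c).
Context (yY : forall k, `|y k| <= Y) (ycv : cvgn (series (fun k => y k ^+ 2))).
Local Notation S := (limn (series (fun k => y k ^+ 2))).

Lemma log_ratio_sum_ge0 : 0 <= S.
Proof.
apply: limr_ge => //; apply: nearW => n; apply: sumr_ge0 => k _; exact: sqr_ge0.
Qed.

Lemma d_aiHS_sqr : d_aiHS ip A gamma B mu ^+ 2 = S + ln c ^+ 2.
Proof.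
have [bL Le] := op_log_eigen Hnorm bX he Xe m0 mxM.
pose L z := op_log ip X z + (- ln c) *: z.
have bL' : bounded_op L by apply: bounded_opD => //; apply: bounded_opZ; exact: bounded_op_id.
have L'e k : L (e k) = y k *: e k by rewrite /L Le -scalerDl.
have LE : op_log ip X = add_scalar L (ln c).
  by apply/funext => z; rewrite /add_scalar /L scaleNr subrK.
have sumL : hs_sum ip L = S%:E.
  rewrite (hs_sum_eigen Hnorm Hsep Hdim (eigen_selfadjoint Hnorm he bL' L'e) he L'e).
  exact: cvg_nneseries.
have hL : hilbert_schmidt ip L by split=> //; rewrite sumL ltry.
rewrite /d_aiHS LE (ehs_norm_add_scalar Hnorm hb _ hL) sqr_sqrtr.
  by rewrite /hs_norm sumL sqr_sqrtr// log_ratio_sum_ge0.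
by rewrite addr_ge0 ?sqr_ge0.
Qed.

(** [D] is the Fredholm determinant of K and [tau] its trace; only the estimate relating them is
    exported. *)
Lemma AB_logdet_eq (a r : R) : 0 < a -> `|r| * Y <= 1 ->
  let d := gamma `^ r / (gamma `^ r + mu `^ r) in
  let tau := limn (series (fun k => divergence_density d r (y k))) in
  exists2 D : R, tau <= 2^-1 -> `|D - 1 - tau| <= 2 * tau ^+ 2 &
    AB_logdet ip a a r A gamma B mu = (a * a)^-1 *
      ln ((expR (r * ln c / 2) + expR (- (r * ln c / 2))) / 2 * D).
Proof.
move=> a0 rY d tau.
have gamma0 := PC2_scalar_gt0 HA; have mu0 := PC2_scalar_gt0 HB.
have c0 : 0 < c by rewrite divr_gt0.
have gr0 : 0 < gamma `^ r := powR_gt0 r gamma0.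
have mr0 : 0 < mu `^ r := powR_gt0 r mu0.
have d01 : 0 <= d <= 1.
  rewrite divr_ge0 ?(ltW gr0) ?addr_ge0 ?(ltW gr0) ?(ltW mr0)//=.
  by rewrite ler_pdivrMr ?addr_gt0// mul1r lerDl ltW.
pose p := r * (1 - d); pose q := r * d.
have x0 k : 0 < x k by have /andP[/(lt_le_trans m0)] := mxM k.
(* The scalar part of the operator inside det_X: the mean of the two powers at x = c. *)
pose G := (expR (p * ln c) + expR (- q * ln c)) / 2.
have G0 : 0 < G by rewrite divr_gt0// addr_gt0// expR_gt0.
have cr : gamma `^ r = expR (r * ln c) * mu `^ r.
  rewrite /powR !gt_eqF// -expRD ln_div ?posrE//; congr expR; ring.
(* The two summands of [G] have ratio c^r = gamma^r / mu^r = d / (1 - d), which turns d and 1 - d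
   into their shares of [G]. *)
have dG : expR (p * ln c) / 2 = d * G /\ expR (- q * ln c) / 2 = (1 - d) * G.
  have pq : expR (p * ln c) = expR (r * ln c) * expR (- q * ln c).
    by rewrite -expRD; congr expR; rewrite /p /q; ring.
  have er0 := expR_gt0 (r * ln c).
  have dE : d = expR (r * ln c) / (expR (r * ln c) + 1).
    rewrite /d cr; field.
    by rewrite !gt_eqF// ?addr_gt0// ?mulr_gt0.
  rewrite /G pq dE; split; field; by rewrite gt_eqF// addr_gt0.
have [bp pe] := op_pow_eigen Hnorm bX he Xe m0 mxM p.
have [bq qe] := op_pow_eigen Hnorm bX he Xe m0 mxM (- q).
pose T z := (a + a)^-1 *: (a *: op_pow ip X p z + a *: op_pow ip X (- q) z).
have bT : bounded_op T.
  by apply: bounded_opZ; apply: bounded_opD; exact: bounded_opZ.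
have Te k : T (e k) = (G * (1 + divergence_density d r (y k))) *: e k.
  rewrite /T pe qe !scalerA -scalerDl scalerA; congr (_ *: _).
  have aa : (a + a)^-1 * (a * x k `^ p + a * x k `^ (- q)) = (x k `^ p + x k `^ (- q)) / 2.
    by field; rewrite !gt_eqF// addr_gt0.
  rewrite aa /powR gt_eqF// mulrDl.
  have ex (s : R) : expR (s * ln (x k)) = expR (s * ln c) * expR (s * y k).
    by rewrite -expRD; congr expR; ring.
  rewrite !ex mulrAC dG.1 [X in _ + X]mulrAC dG.2 /divergence_density -/p -/q.
  by rewrite mulNr; ring.
have taucv := is_cvg_divergence_sum yY ycv d01 rY.
pose C z := T z + (- G) *: z.
have bC : bounded_op C by apply: bounded_opD => //; apply: bounded_opZ; exact: bounded_op_id.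
have Ce k : C (e k) = (G * divergence_density d r (y k)) *: e k.
  by rewrite /C Te -scalerDl; congr (_ *: _); ring.
have TE : T = add_scalar C G.
  by apply/funext => z; rewrite /add_scalar /C scaleNr subrK.
have k0 k : 0 <= divergence_density d r (y k) by exact: divergence_density_ge0.
have trC : trace_class ip C.
  apply: (trace_class_eigen Hnorm hb bC he Ce) => [k|].
    by rewrite mulr_ge0// ltW.
  exact: is_cvg_seriesZ.
pose K z := G^-1 *: C z.
have bK : bounded_op K by exact: bounded_opZ.
have Ke k : K (e k) = divergence_density d r (y k) *: e k.
  by rewrite /K Ce scalerA mulrA mulVf ?mul1r// gt_eqF.
have sK := eigen_selfadjoint Hnorm he bK Ke.
have trK : (\sum_(0 <= k <oo) (ip (onb ip k) (K (onb ip k)))%:E = tau%:E)%E.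
  by rewrite (trace_basis Hnorm he hb bK Ke k0); exact: cvg_nneseries.
have K0 z : 0 <= ip z (K z).
  rewrite ipC; apply: (cvgr_to_ge (cvg_ip_eigen Hnorm he z z bK Ke)).
  apply: nearW => n; apply: sumr_ge0 => k _.
  by rewrite mulr_ge0// -expr2 sqr_ge0.
exists (fredholm_det ip K).
  exact: (fredholm_det_approx sK K0 trK).
rewrite /AB_logdet.
have -> : a * gamma `^ r / (a * gamma `^ r + a * mu `^ r) = d.
  by rewrite /d; field; rewrite !gt_eqF// ?addr_gt0// mulr_gt0.
congr (_ * ln _).
rewrite -/p -/q -/T TE (detX_add_scalar Hnorm hb trC) ?gt_eqF//.
rewrite mulrA; congr (_ * _).
have -> : a / (a + a) = 2^-1 by field; rewrite !gt_eqF// addr_gt0.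
(* The exponent r (d - 1/2) of the prefactor shifts r (1-d) to r / 2 and -r d to -r / 2, giving the
   symmetric cosh. *)
rewrite /powR gt_eqF// /G mulrA mulrDr -!expRD; congr ((expR _ + expR _) / _).
- by rewrite /p; field.
- by rewrite /q; field.
Qed.

End Eigen.
End Divergence.

(** * Passing to the limit *)

Section Limit.
Context (R : realType).

Lemma cvg_approx (T : Type) (F : set_system T) {FF : Filter F} (f g b : T -> R) (l : R) :
  f t @[t --> F] --> l -> b t @[t --> F] --> 0 ->
  (\forall t \near F, `|g t - f t| <= b t) -> g t @[t --> F] --> l.
Proof.
move=> fl b0 gf.
have h : g t - f t @[t --> F] --> 0.
  apply: (@squeeze_cvgr _ _ _ _ (fun t => - b t) b) => //; last first.
    by rewrite -oppr0; exact: cvgN.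
  by apply: filterS gf => t; rewrite ler_norml.
have -> : g = fun t => f t + (g t - f t) by apply/funext => t; rewrite addrC subrK.
by rewrite -[l]addr0; exact: cvgD.
Qed.

(** Squeeze by h / (1 + h) <= ln (1 + h) <= h, multiplied by the weight; the weight may be
    unbounded, as it is for a^-2. The lower bound is the upper one applied to 1 / (1 + h). *)
Lemma cvg_ln1D (T : Type) (F : set_system T) {FF : Filter F} (h w : T -> R) (l : R) :
  h t @[t --> F] --> 0 -> h t * w t @[t --> F] --> l -> (\forall t \near F, 0 <= w t) ->
  ln (1 + h t) * w t @[t --> F] --> l.
Proof.
move=> h0 hw w0.
have inv1 : (1 + h t)^-1 @[t --> F] --> (1 : R).
  rewrite -[X in _ --> X]invr1; apply: cvgV => //.
  by rewrite -[X in _ --> X]addr0; apply: cvgD => //; exact: cvg_cst.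
apply: (@squeeze_cvgr _ _ _ _ (fun t => h t * w t * (1 + h t)^-1) (fun t => h t * w t)) => //.
  have hh : \forall t \near F, `|h t| < 2^-1.
    by have /cvgr0Pnorm_lt := h0; apply; rewrite invr_gt0.
  near=> t.
  have w0' : 0 <= w t by near: t.
  have : `|h t| < 2^-1 by near: t.
  rewrite ltr_norml => /andP[h1 h2].
  have h3 : 0 < 1 + h t by lra.
  rewrite mulrAC; apply/andP; split; apply: ler_wpM2r => //; last first.
    by apply: le_ln1Dx; lra.
  rewrite -[leRHS]opprK -lnV ?posrE// lerNr.
  rewrite [X in ln X](_ : _ = 1 + (- (h t / (1 + h t)))); last first.
    by field; rewrite gt_eqF.
  apply: le_ln1Dx; rewrite ltrN2 ltr_pdivrMr// mul1r; lra.
by rewrite -[X in _ --> X]mulr1; exact: cvgM.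
Unshelve. all: by end_near. Qed.

(** With w = a^-2 and q = r / a, errors of order |r|^3 become q^2 |r|, which tends to 0. The cosh
    factor and [D] are handled separately and recombined by ch D - 1 = (ch - 1) D + (D - 1). *)
Lemma divergence_limit (T : Type) (F : set_system T) {FF : ProperFilter F}
    (a r d tau D : T -> R) (r0 S E l : R) :
  (\forall t \near F, 0 < a t) -> a t @[t --> F] --> 0 ->
  r t / a t @[t --> F] --> r0 -> d t @[t --> F] --> (2^-1 : R) ->
  (\forall t \near F,
    `|tau t - r t ^+ 2 * (d t * (1 - d t)) / 2 * S| <= E * `|r t| ^+ 3) ->
  (\forall t \near F, tau t <= 2^-1 -> `|D t - 1 - tau t| <= 2 * tau t ^+ 2) ->
  (a t * a t)^-1 * ln ((expR (r t * l / 2) + expR (- (r t * l / 2))) / 2 * D t)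
    @[t --> F] --> r0 ^+ 2 / 8 * (S + l ^+ 2).
Proof.
move=> a_gt0 a0 ra d2 tauE DE.
pose w t := (a t * a t)^-1; pose q t := r t / a t.
have w0 : \forall t \near F, 0 <= w t.
  by apply: filterS a_gt0 => t at0; rewrite invr_ge0 mulr_ge0// ltW.
have rr0 : r t @[t --> F] --> 0.
  have : q t * a t @[t --> F] --> r0 * 0 by exact: cvgM.
  rewrite mulr0; apply: cvg_trans; apply: near_eq_cvg.
  by apply: filterS a_gt0 => t at0; rewrite /q divfK// gt_eqF.
have q2 : q t ^+ 2 @[t --> F] --> r0 ^+ 2 by rewrite expr2; exact: cvgM.
have nr0 : `|r t| @[t --> F] --> 0 by rewrite -[X in _ --> X](normr0 R); exact: cvg_norm.
have err0 (k : R) : k * (q t ^+ 2 * `|r t|) @[t --> F] --> 0.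
  rewrite -[X in _ --> X](mulr0 k) -(mulr0 (r0 ^+ 2)).
  by apply: cvgM; [exact: cvg_cst|exact: cvgM].
have r3w t : 0 < a t -> `|r t| ^+ 3 * w t = q t ^+ 2 * `|r t|.
  by move=> at0; rewrite /q /w exprS real_normK ?num_real//; field; rewrite gt_eqF.
pose ch t := (expR (r t * l / 2) + expR (- (r t * l / 2))) / 2.
have chw : (ch t - 1) * w t @[t --> F] --> (r0 ^+ 2 * l ^+ 2 / 8 : R).
  apply: (@cvg_approx _ _ _ (fun t => q t ^+ 2 * (l ^+ 2 / 8)) _
    (fun t => expR 1 * `|l / 2| ^+ 3 * (q t ^+ 2 * `|r t|))) => //.
    by rewrite -mulrA; apply: cvgM => //; exact: cvg_cst.
  have u0 : r t * l / 2 @[t --> F] --> 0.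
    rewrite -(mul0r (l / 2)); under eq_fun do rewrite -mulrA.
    by apply: cvgM => //; exact: cvg_cst.
  have u1 : \forall t \near F, `|r t * l / 2| <= 1.
    by have /cvgr0Pnorm_le := u0; apply.
  near=> t.
  have at0 : 0 < a t by near: t.
  have ut1 : `|r t * l / 2| <= 1 by near: t.
  set u := r t * l / 2 in ut1.
  have h1 := expR_taylor2 ut1.
  have : `| - u| <= 1 by rewrite normrN.
  move=> /expR_taylor2; rewrite normrN => h2.
  (* Averaging the expansions at u and -u removes the odd term; u^2 / 2 with u = r l / 2 gives r^2
     l^2 / 8. *)
  have -> : (ch t - 1) * w t - q t ^+ 2 * (l ^+ 2 / 8) =
      ((expR u - 1 - u - u ^+ 2 / 2) + (expR (- u) - 1 - - u - (- u) ^+ 2 / 2)) / 2 * w t.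
    by rewrite /ch -/u /q /w /u; field; rewrite gt_eqF.
  rewrite normrM [X in _ * X]ger0_norm; last by near: t.
  have -> : expR 1 * `|l / 2| ^+ 3 * (q t ^+ 2 * `|r t|) = expR 1 * `|u| ^+ 3 * w t.
    rewrite -r3w// /u -[r t * l / 2]mulrA [`|r t * _|]normrM exprMn; ring.
  apply: ler_wpM2r; first by near: t.
  rewrite normrM normfV [`|2|]ger0_norm// ler_pdivrMr//.
  by rewrite (le_trans (ler_normD _ _))//; lra.
have tauw : tau t * w t @[t --> F] --> r0 ^+ 2 * S / 8.
  apply: (@cvg_approx _ _ _ (fun t => q t ^+ 2 * (d t * (1 - d t) / 2 * S)) _
    (fun t => E * (q t ^+ 2 * `|r t|))) => //.
    have -> : r0 ^+ 2 * S / 8 = r0 ^+ 2 * (2^-1 * (1 - 2^-1) / 2 * S) by field.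
    apply: cvgM => //; apply: cvgM; last exact: cvg_cst.
    apply: cvgM; last exact: cvg_cst.
    by apply: cvgM => //; apply: cvgB => //; exact: cvg_cst.
  near=> t.
  have at0 : 0 < a t by near: t.
  rewrite -r3w// [leRHS]mulrA.
  have -> : tau t * w t - q t ^+ 2 * (d t * (1 - d t) / 2 * S) =
      (tau t - r t ^+ 2 * (d t * (1 - d t)) / 2 * S) * w t.
    by rewrite /q /w; field; rewrite gt_eqF.
  rewrite normrM [X in _ * X]ger0_norm; last by near: t.
  by apply: ler_wpM2r; near: t.
have aa0 : a t * a t @[t --> F] --> 0 by rewrite -(mulr0 0); exact: cvgM.
have tau0 : tau t @[t --> F] --> 0.
  have : tau t * w t * (a t * a t) @[t --> F] --> r0 ^+ 2 * S / 8 * 0 by exact: cvgM.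
  rewrite mulr0; apply: cvg_trans; apply: near_eq_cvg.
  by apply: filterS a_gt0 => t at0; rewrite /w mulfVK// mulf_neq0// gt_eqF.
(* The quadratic error survives division by a^2, because tau^2 w = tau (tau w) with tau w convergent
   and tau -> 0. *)
have Dw : (D t - 1) * w t @[t --> F] --> r0 ^+ 2 * S / 8.
  apply: (@cvg_approx _ _ _ (fun t => tau t * w t) _
    (fun t => 2 * (tau t * (tau t * w t)))) => //.
    rewrite -(mulr0 2) -(mul0r (r0 ^+ 2 * S / 8)).
    by apply: cvgM; [exact: cvg_cst|exact: cvgM].
  have tau2 : \forall t \near F, `|tau t| <= 2^-1.
    by have /cvgr0Pnorm_le := tau0; apply; rewrite invr_gt0.
  near=> t.
  have wt0 : 0 <= w t by near: t.
  have tt2 : tau t <= 2^-1.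
    by rewrite (le_trans (ler_norm _))//; near: t.
  rewrite -mulrBl normrM [X in _ * X]ger0_norm//.
  have -> : 2 * (tau t * (tau t * w t)) = 2 * tau t ^+ 2 * w t by ring.
  by apply: ler_wpM2r => //; move: tt2; near: t.
have D1 : D t @[t --> F] --> (1 : R).
  have : 1 + (D t - 1) * w t * (a t * a t) @[t --> F] --> 1 + r0 ^+ 2 * S / 8 * 0.
    by apply: cvgD; [exact: cvg_cst|exact: cvgM].
  rewrite mulr0 addr0; apply: cvg_trans; apply: near_eq_cvg.
  apply: filterS a_gt0 => t at0.
  by rewrite /w mulfVK ?mulf_neq0 ?gt_eqF// addrC subrK.
have hw : (ch t * D t - 1) * w t @[t --> F] --> r0 ^+ 2 / 8 * (S + l ^+ 2).
  have -> : r0 ^+ 2 / 8 * (S + l ^+ 2) = r0 ^+ 2 * l ^+ 2 / 8 * 1 + r0 ^+ 2 * S / 8.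
    by field.
  have -> : (fun t => (ch t * D t - 1) * w t) =
      (fun t => (ch t - 1) * w t * D t + (D t - 1) * w t).
    by apply/funext => t; ring.
  by apply: cvgD => //; exact: cvgM.
have h0 : ch t * D t - 1 @[t --> F] --> 0.
  have : (ch t * D t - 1) * w t * (a t * a t) @[t --> F] -->
      r0 ^+ 2 / 8 * (S + l ^+ 2) * 0 by exact: cvgM.
  rewrite mulr0; apply: cvg_trans; apply: near_eq_cvg.
  by apply: filterS a_gt0 => t at0; rewrite /w mulfVK// mulf_neq0// gt_eqF.
have -> : (fun t => (a t * a t)^-1 *
    ln ((expR (r t * l / 2) + expR (- (r t * l / 2))) / 2 * D t)) =
    (fun t => ln (1 + (ch t * D t - 1)) * w t).
  by apply/funext => t; rewrite (addrC 1) subrK mulrC.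
exact: cvg_ln1D.
Unshelve. all: by end_near. Qed.

End Limit.

Lemma cvg_powR0 (R : realType) (T : Type) (F : set_system T) {FF : Filter F}
    (g : R) (r : T -> R) : 0 < g -> r t @[t --> F] --> (0 : R) ->
  g `^ r t @[t --> F] --> (1 : R).
Proof.
move=> g0 r0; rewrite -(powRr0 g) /powR gt_eqF//.
apply: continuous_cvg; first exact: continuous_expR.
by apply: cvgM => //; exact: cvg_cst.
Qed.

(** Stating the behaviour of r through [r a / a] lets the smooth and the linear case share one
    proof. *)
Lemma cvg_AB_logdet (R : realType) (H : completeNormedModType R)
    (ip : {dot H for @idfun R}) (A B : H -> H) (gamma mu : R) (r : R -> R) (r0 : R) :
  hilbert_norm ip -> separable H -> infinite_dimensional H ->
  PC2 ip A gamma -> PC2 ip B mu -> r a / a @[a --> 0^'+] --> r0 ->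
  AB_logdet ip a a (r a) A gamma B mu @[a --> 0^'+] -->
    r0 ^+ 2 / 8 * d_aiHS ip A gamma B mu ^+ 2.
Proof.
move=> Hnorm Hsep Hdim HA HB ra.
have gamma0 := PC2_scalar_gt0 Hnorm Hsep Hdim HA.
have mu0 := PC2_scalar_gt0 Hnorm Hsep Hdim HB.
have [e [x [m [M [bX he Xe [m0 mxM] [Y [yY ycv]]]]]]] :=
  whitened_eigen Hnorm Hsep Hdim HA HB.
rewrite (d_aiHS_sqr Hnorm Hsep Hdim bX he Xe m0 mxM ycv).
set S := limn _.
pose d a := gamma `^ r a / (gamma `^ r a + mu `^ r a).
pose tau a := limn (series (fun k =>
  divergence_density (d a) (r a) (ln (x k) - ln (gamma / mu)))).
pose ch a := (expR (r a * ln (gamma / mu) / 2) + expR (- (r a * ln (gamma / mu) / 2))) / 2.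
(* [D] has to be a function of every a, while its equation holds only for a > 0 and
   [|r a| * Y <= 1]; elsewhere the value 0 is arbitrary. *)
have /choice[D DP] a : exists D, 0 < a -> `|r a| * Y <= 1 ->
    (tau a <= 2^-1 -> `|D - 1 - tau a| <= 2 * tau a ^+ 2) /\
    AB_logdet ip a a (r a) A gamma B mu = (a * a)^-1 * ln (ch a * D).
  have [[a0 rY]|n] := pselect (0 < a /\ `|r a| * Y <= 1); last first.
    by exists 0 => a0 rY; case: n.
  have [D D1 D2] := AB_logdet_eq Hnorm Hsep Hdim HA HB bX he Xe m0 mxM yY ycv a0 rY.
  by exists D.
have a_gt0 : \forall a \near (0 : R)^'+, 0 < a by exact: nbhs_right_gt.
have a0 : a @[a --> (0 : R)^'+] --> (0 : R) by exact: cvg_at_right_filter.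
have rr0 : r a @[a --> 0^'+] --> (0 : R).
  have : r a / a * a @[a --> 0^'+] --> r0 * 0 by exact: cvgM.
  rewrite mulr0; apply: cvg_trans; apply: near_eq_cvg.
  by apply: filterS a_gt0 => a at0; rewrite divfK// gt_eqF.
have rY : \forall a \near (0 : R)^'+, `|r a| * Y <= 1.
  have : `|r a| * Y @[a --> 0^'+] --> `|0 : R| * Y.
    by apply: cvgM; [exact: cvg_norm|exact: cvg_cst].
  rewrite normr0 mul0r.
  move=> /cvgr0Pnorm_le/(_ 1 ltr01); apply: filterS => a.
  exact: le_trans (ler_norm _).
have d01 a : 0 <= d a <= 1.
  have g0 := powR_gt0 (r a) gamma0; have u0 := powR_gt0 (r a) mu0.
  rewrite /d divr_ge0 ?(ltW g0) ?addr_ge0 ?(ltW g0) ?(ltW u0)//=.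
  by rewrite ler_pdivrMr ?addr_gt0// mul1r lerDl ltW.
have d2 : d a @[a --> 0^'+] --> (2^-1 : R).
  have -> : 2^-1 = 1 / (1 + 1) :> R by rewrite div1r.
  apply: cvgM; first exact: cvg_powR0.
  by apply: cvgV => //; apply: cvgD; exact: cvg_powR0.
have : (a * a)^-1 * ln (ch a * D a) @[a --> 0^'+] -->
    r0 ^+ 2 / 8 * (S + ln (gamma / mu) ^+ 2).
  apply: (divergence_limit (a := id) (d := d) (tau := tau) (D := D)
    (E := expR 1 * Y * S)) => //.
    near=> a; have raY : `|r a| * Y <= 1 by near: a.
    rewrite (le_trans (divergence_sum_approx yY ycv (d01 a) raY))//.
    by rewrite -/S le_eqVlt; apply/orP; left; apply/eqP; ring.
  near=> a; have at0 : 0 < a by near: a.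
  have raY : `|r a| * Y <= 1 by near: a.
  by have [] := DP a at0 raY.
apply: cvg_trans; apply: near_eq_cvg; near=> a.
have at0 : 0 < a by near: a.
have raY : `|r a| * Y <= 1 by near: a.
by have [_ ->] := DP a at0 raY.
Unshelve. all: by end_near. Qed.

Theorem theorem3 (R : realType) (H : completeNormedModType R)
    (ip : {dot H for @idfun R})
    (Hnorm : hilbert_norm ip) (Hsep : separable H)
    (Hdim : infinite_dimensional H)
    (A B : H -> H) (gamma mu : R)
    (HA : PC2 ip A gamma) (HB : PC2 ip B mu) :
  (forall r : R -> R,
     smooth_near r 0 -> r 0 = 0 -> derive1 r 0 != 0 ->
     (\forall a \near (0 : R), a != 0 -> r a != 0) ->
     AB_logdet ip a a (r a) A gamma B mu @[a --> 0^'+] -->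
       (derive1 r 0) ^+ 2 / 8 * d_aiHS ip A gamma B mu ^+ 2) /\
  (AB_logdet ip a a (2 * a) A gamma B mu @[a --> 0^'+] -->
     2^-1 * d_aiHS ip A gamma B mu ^+ 2).
Proof.
split=> [r rsmooth r00 _ _|].
  apply: cvg_AB_logdet => //; apply: cvg_dnbhs_at_right.
  (* Smoothness at order 0 is derivability of r at 0; as [r 0 = 0], the difference quotient is
     [r a / a]. *)
  have := nbhs_singleton rsmooth 0%N; rewrite derive1E /derive1n/=.
  rewrite /derivable/= => dr.
  suff -> : (fun a => r a / a) = (fun h => h^-1 *: ((r \o shift 0) (h *: 1) - r 0)) by exact: dr.
  apply/funext => a /=; rewrite addr0 r00 subr0 mulrC.
  by congr (_ * r _); rewrite /GRing.scale/= mulr1.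
have -> : 2^-1 = 2 ^+ 2 / 8 :> R by field.
apply: (@cvg_AB_logdet _ _ _ _ _ _ _ (fun a => 2 * a)) => //.
apply: cvg_near_cst; near=> a.
have a0 : 0 < a by near: a; exact: nbhs_right_gt.
by rewrite mulfK// gt_eqF.
Unshelve. all: by end_near. Qed.
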